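(* Let $f$ be a $C^\infty$ function defined in an open set $\Omega\subset\mathbb{R}^2$ containing the origin, let $\Gamma=\{(t,\phi(t)):t\in I\}$ be a non-linear analytic curve in $\mathbb{R}^2$ passing through or ending at the origin, and let $E\subset\mathbb{R}\setminus\{0\}$ be a closed subset of $\mathbb{C}$ of positive capacity. For $s\in E$ let $\Gamma_s=\{(st,s\phi(t)):t\in I\}$. Suppose that for each $s\in E$ there is a real analytic function $F_s$ defined in a neighborhood $Q_s$ of $\Gamma_s\cap\Omega$ in $\mathbb{R}^2$ such that $f$ and $F_s$ coincide on $\Gamma_s\cap\Omega$. Then there is a neighborhood $U$ of the origin and a real analytic function $F$ defined on $U$ that coincides with $f$ on $U\cap\Lambda$, where $\Lambda:=\bigcup_{s\in E}\Gamma_s$.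
   Context: Functions $f$, $F_s$, $F$ are complex-valued functions of real variables; $\phi$ is real-valued. Here $I\subset\mathbb{R}$ is a non-degenerate interval containing $0$ (as an interior point when the curve passes through the origin, as an endpoint when it ends at the origin), $\phi$ is real analytic on $I$ (including at endpoints belonging to $I$), and $\phi(0)=0$. Non-linear means $\phi$ is not of the form $t\mapsto ct$. Capacity means logarithmic capacity in $\mathbb{C}\supset\mathbb{R}$: for a compact set $E\subset\mathbb{C}$, $\operatorname{cap}(E)=\exp\left(-\min_{\mu}\sup_{z\in\mathbb{C}}p_\mu(z)\right)$, where $\mu$ ranges over probability measures on $E$ and $p_\mu(z)=\lim_{N\to\infty}\int\min\left(N,\log\frac{1}{|z-\zeta|}\right)d\mu(\zeta)$; for a closed set $E$, $\operatorname{cap}(E)=\lim_n\operatorname{cap}(E\cap\{|z|\le n\})$. *)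

(* Defs.v *)
From HB Require Import structures.
From mathcomp Require Import all_boot all_order all_algebra.
From mathcomp Require Import complex.
From mathcomp Require Import all_classical all_reals all_analysis.

Set Implicit Arguments.
Unset Strict Implicit.
Unset Printing Implicit Defensive.

Import Order.TTheory GRing.Theory Num.Theory.
Import numFieldNormedType.Exports.
Import ComplexField.Normc.

Local Open Scope classical_set_scope.
Local Open Scope ring_scope.
Local Open Scope complex_scope.

(* R[i] itself carries no topology; seen as a numFieldType it inherits the
   norm topology. *)
Definition Cplx (R : realType) : numFieldType := R[i].

Section Functions.
Variable R : realType.

(* For open Om this is the usual C^k: the values of u outside Om play no role,
   since continuity and derivatives at a point of Om are local. *)
Fixpoint Ck (k : nat) (Om : set (R * R)) (u : R * R -> R) : Prop :=
  (forall p, Om p -> {for p, continuous u}) /\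
  match k with
  | 0%N => True
  | k'.+1 =>
      [/\ forall p, Om p -> derivable u p (1, 0) /\ derivable u p (0, 1),
          Ck k' Om (fun p => 'D_(1, 0) u p) &
          Ck k' Om (fun p => 'D_(0, 1) u p)]
  end.

Definition smooth_on (Om : set (R * R)) (f : R * R -> R[i]) : Prop :=
  forall k, Ck k Om (fun p => complex.Re (f p)) /\
            Ck k Om (fun p => complex.Im (f p)).

(* The double power series must converge absolutely; its sum, which does not
   depend on the order of summation, is taken along square partial sums. *)
Definition analytic_at (u : R * R -> R) (p : R * R) : Prop :=
  exists (a : nat -> nat -> R) (r : R), 0 < r /\
    forall q : R * R, `|q.1 - p.1| < r -> `|q.2 - p.2| < r ->
      summable [set: nat * nat]
        (fun jk => (a jk.1 jk.2 * (q.1 - p.1) ^+ jk.1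
                                * (q.2 - p.2) ^+ jk.2)%:E) /\
      (fun n : nat => \sum_(j < n) \sum_(k < n)
         a j k * (q.1 - p.1) ^+ j * (q.2 - p.2) ^+ k) @ \oo --> u q.

Definition analytic_on (U : set (R * R)) (F : R * R -> R[i]) : Prop :=
  forall p, U p -> analytic_at (fun q => complex.Re (F q)) p /\
                   analytic_at (fun q => complex.Im (F q)) p.

(* At an endpoint of I belonging to I, the power series is only required to
   represent phi on the side of t0 lying in I. *)
Definition analytic_on_itv (I : set R) (phi : R -> R) : Prop :=
  forall t0, I t0 -> exists (a : nat -> R) (r : R), 0 < r /\
    forall t, I t -> `|t - t0| < r -> pseries a (t - t0) @ \oo --> phi t.

Definition dilated_curve (I : set R) (phi : R -> R) (s : R) : set (R * R) :=
  [set (s * t, s * phi t) | t in I].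

End Functions.

Section Capacity.
Variable R : realType.

Notation Cborel := (g_sigma_algebraType (@open (Cplx R))).

Local Open Scope ereal_scope.

(* log (1 / |z - w|); the inverse is that of \bar R, hence the value is +oo
   when z = w. *)
Definition log_kernel (z w : R[i]) : \bar R :=
  lne ((normc (z - w)%R)%:E^-1).

Definition potential (mu : probability Cborel R) (z : R[i]) : \bar R :=
  limn (fun N : nat =>
    \int[mu]_w Order.min (N%:R)%:E (log_kernel z (w : R[i]))).

(* The minimum over mu is written as an infimum in \bar R (it is attained when
   K is a nonempty compact set); if K is empty the capacity is 0. *)
Definition cap_compact (K : set R[i]) : \bar R :=
  expeR (- ereal_inf
    [set ereal_sup (range (potential mu)) | mu in
       [set mu : probability Cborel R | mu (K : set Cborel) = 1]]).

Definition cap (E : set R[i]) : \bar R :=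
  limn (fun n : nat =>
    cap_compact (E `&` [set z : R[i] | (normc z <= n%:R)%R])).

End Capacity.

(* Main.v *)
Require Import Defs.
From HB Require Import structures.
From mathcomp Require Import all_boot all_order all_algebra.
From mathcomp Require Import complex ring lra zify.
From mathcomp Require Import all_classical all_reals all_analysis.
From mathcomp Require Import measurable_realfun.

(** The function F is the sum of the Taylor series of f at the origin; the
    point is that this series converges. The real and imaginary parts of f are
    independent of each other, so let u be real-valued, with Taylor
    coefficients a_jk.

    Near 0 write phi(t) = t psi(t). Collecting the homogeneous parts of the
    Taylor series of u gives, formally,
      u (s t, s phi(t)) = sum_d (s t)^d q_d(psi(t)) = sum_n P_n(s) t^n,
    where q_d(y) = sum_k a_(d-k)k y^k and P_n is a polynomial of degree at most
    n whose coefficient of s^d is that of t^(n-d) in q_d(psi(t)). For s in E the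
    left-hand side is an analytic function of t, and its coefficients are
    indeed the P_n(s) because asymptotic expansions are unique
    ([taylor_along_curve]). Hence |P_n(s)| <= C(s)^(n+1) for every n.

    A set of positive capacity turns these pointwise bounds into a bound
    C^(n+1) on the coefficients of all the P_n ([pos_cap_coef_bound]). Indeed E
    is a countable union of closed sets on which the bound is uniform, one of
    which, K', has positive mass for a measure with bounded potential. Given
    the roots z_i of a polynomial, averaging the sum of the log(1/|w - z_i|)
    over K' produces a point w of K' that is not exponentially close to them,
    so that |P(w)| controls the Mahler measure of P, hence its coefficients
    ([far_from_roots], [coef_le_of_roots]).

    Consequently |q_d(psi(t))| <= 2 C^(d+1) for all small t. As phi is not
    linear, the slopes psi(t) fill an interval ([nonlinear_interval]), and
    Lagrange interpolation on this interval bounds the coefficients of q_d,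
    which are the Taylor coefficients of u of order d, by C'^(d+1)
    ([interval_coef_bound], [geom_bound_of_curves]). So the Taylor series of u
    converges to an analytic function F near the origin ([dsum_analytic]).

    On each dilated curve u and F are analytic in t and have the same
    expansion at t = 0, so they agree on the part of the curve lying in a small
    square by the identity theorem on an interval ([analytic_eq0]). The square
    can be chosen independently of s because E, closed and without 0, stays
    away from 0 ([real_valued_extension]). *)

Import Order.TTheory GRing.Theory Num.Theory.
Import numFieldNormedType.Exports.

Local Open Scope classical_set_scope.
Local Open Scope ring_scope.
Local Open Scope complex_scope.
Set Implicit Arguments.
Unset Strict Implicit.
Unset Printing Implicit Defensive.
Import ComplexField.Normc.

(** * Absolutely convergent double series *)

Definition sums_to (R : realType) (a : nat -> R) (l : R) : Prop :=
  (fun N => \sum_(i < N) a i) @ \oo --> l.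

Definition square_sum (R : realType) (A : nat -> nat -> R) (N : nat) : R :=
  \sum_(i < N) \sum_(j < N) A i j.

(** The order of summation that substitution produces, whereas square sums are those
    of the definition of analyticity. *)
Definition triangle_sum (R : realType) (A : nat -> nat -> R) (N : nat) : R :=
  \sum_(n < N) \sum_(i < n.+1) A i (n - i)%N.

Lemma ler_psum (R : realType) (a : nat -> R) (m n : nat) :
  (forall i, 0 <= a i) -> (m <= n)%N -> \sum_(i < m) a i <= \sum_(i < n) a i.
Proof.
move=> a0 mn; rewrite -(subnKC mn) big_split_ord/= lerDl.
by apply: sumr_ge0 => i _.
Qed.

Lemma triangle_sumE (R : realType) (A : nat -> nat -> R) (N : nat) :
  triangle_sum A N = \sum_(i < N) \sum_(j < N - i) A i j.
Proof.
rewrite /triangle_sum; elim: N => [|N IH]; first by rewrite !big_ord0.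
rewrite big_ord_recr/= IH.
have -> : \sum_(i < N.+1) \sum_(j < N.+1 - i) A i j =
    \sum_(i < N.+1) (\sum_(j < N - i) A i j + A i (N - i)%N).
  by apply: eq_bigr => i _; rewrite (subSn (ltn_ord i : (i <= N)%N)) big_ord_recr.
rewrite big_split/= [X in _ = X + _]big_ord_recr/= subnn.
by rewrite [X in _ = _ + X + _]big_ord0 addr0.
Qed.

Lemma triangle_le_square (R : realType) (A : nat -> nat -> R) (N : nat) :
  (forall i j, 0 <= A i j) -> triangle_sum A N <= square_sum A N.
Proof.
move=> A0; rewrite triangle_sumE; apply: ler_sum => i _.
by apply: (ler_psum (a := A i)) => //; rewrite leq_subr.
Qed.

Lemma square_le_triangle (R : realType) (A : nat -> nat -> R) (N : nat) :
  (forall i j, 0 <= A i j) -> square_sum A N./2 <= triangle_sum A N.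
Proof.
move=> A0; rewrite triangle_sumE.
apply: (@le_trans _ _ (\sum_(i < N./2) \sum_(j < N - i) A i j)).
  apply: ler_sum => i _; apply: (ler_psum (a := A i)) => //.
  by have := ltn_ord i; lia.
apply: (ler_psum (a := fun i => \sum_(j < N - i) A i j)); last by lia.
by move=> i; apply: sumr_ge0.
Qed.

Lemma square_sum_homo (R : realType) (A : nat -> nat -> R) :
  (forall i j, 0 <= A i j) -> nondecreasing_seq (square_sum A).
Proof.
move=> A0 m n mn; apply: (@le_trans _ _ (\sum_(i < m) \sum_(j < n) A i j)).
  by apply: ler_sum => i _; apply: (ler_psum (a := A i)).
apply: (ler_psum (a := fun i => \sum_(j < n) A i j)) => // i.
exact: sumr_ge0.
Qed.

Lemma cvg_half : (fun n => n./2) @ \oo --> \oo.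
Proof.
apply/cvgnyPge => A; near=> n.
have : (A.*2 <= n)%N by near: n; exact: nbhs_infty_ge.
by move=> h; rewrite -(half_double A) half_leq.
Unshelve. all: by end_near. Qed.

Lemma cvg_psum (R : realType) (f : nat -> nat -> R) (l : nat -> R) (n : nat) :
  (forall i, f i @ \oo --> l i) ->
  (fun M => \sum_(i < n) f i M) @ \oo --> \sum_(i < n) l i.
Proof.
move=> fl; elim: n => [|n IH].
  by rewrite big_ord0; under eq_fun do rewrite big_ord0; exact: cvg_cst.
rewrite big_ord_recr; under eq_fun do rewrite big_ord_recr.
exact: (cvgD IH (fl n)).
Qed.

(** Triangles are squeezed between the squares of half and of full side, and a partial
    sum of the row sums is a limit of rectangles, each of them inside a square; with
    nonnegative terms nothing more than monotone convergence is needed. *)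
Lemma double_series_ge0 (R : realType) (A : nat -> nat -> R) (B : R) :
  (forall i j, 0 <= A i j) -> (forall N, square_sum A N <= B) ->
  exists S : R, [/\ square_sum A @ \oo --> S, triangle_sum A @ \oo --> S &
    forall r, (forall i, sums_to (A i) (r i)) -> sums_to r S].
Proof.
move=> A0 AB; have nd := square_sum_homo A0.
have [S HS] : exists S : R, square_sum A @ \oo --> S.
  exists (limn (square_sum A)); apply: nondecreasing_is_cvgn => //.
  by exists B => _ [n _ <-].
have sqS N : square_sum A N <= S.
  rewrite -(cvg_lim (@Rhausdorff R) HS).
  by apply: nondecreasing_cvgn_le => //; apply/cvg_ex; exists S.
exists S; split=> //.
  apply: (squeeze_cvgr (f := fun N => square_sum A N./2) (h := square_sum A)) => //.
    by apply: nearW => n; rewrite square_le_triangle// triangle_le_square.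
  exact: (cvg_comp _ _ cvg_half HS).
move=> r rA; rewrite /sums_to.
have rge i N : \sum_(j < N) A i j <= r i.
  rewrite -(cvg_lim (@Rhausdorff R) (rA i)).
  apply: (nondecreasing_cvgn_le (u_ := fun N => \sum_(j < N) A i j)).
    by move=> m n mn; apply: (ler_psum (a := A i)).
  by apply/cvg_ex; exists (r i); exact: rA.
apply: (squeeze_cvgr (f := square_sum A) (h := fun=> S)) => //; last exact: cvg_cst.
apply: nearW => N; apply/andP; split; first by apply: ler_sum => i _.
have cN : (fun M => \sum_(i < N) \sum_(j < M) A i j) @ \oo --> \sum_(i < N) r i.
  exact: (cvg_psum (f := fun i M => \sum_(j < M) A i j) rA).
rewrite -(cvg_lim (@Rhausdorff R) cN); apply: limr_le.
  by apply/cvg_ex; eexists; exact: cN.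
near=> M; apply: le_trans (sqS M).
apply: (ler_psum (a := fun i => \sum_(j < M) A i j)) => //.
  by move=> i; exact: sumr_ge0.
by near: M; exact: nbhs_infty_ge.
Unshelve. all: by end_near. Qed.

(** Nonnegativity is recovered from A = (|A| + A) - |A|. Every interchange of
    summations below (Cauchy product, substitution, recentring) is an instance. *)
Lemma double_series (R : realType) (A : nat -> nat -> R) (B : R) :
  (forall N, square_sum (fun i j => `|A i j|) N <= B) ->
  exists S : R, [/\ square_sum A @ \oo --> S, triangle_sum A @ \oo --> S &
    forall r, (forall i, sums_to (A i) (r i)) -> sums_to r S].
Proof.
move=> AB; pose P i j := `|A i j| + A i j.
have P0 i j : 0 <= P i j by rewrite /P -lerBlDr sub0r; have := ler_norm (- A i j); rewrite normrN.
have sqP N : square_sum P N = square_sum (fun i j => `|A i j|) N + square_sum A N.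
  by rewrite /square_sum -big_split/=; apply: eq_bigr => i _; rewrite -big_split.
have trP N : triangle_sum P N = triangle_sum (fun i j => `|A i j|) N + triangle_sum A N.
  by rewrite /triangle_sum -big_split/=; apply: eq_bigr => i _; rewrite -big_split.
have sqA N : square_sum A N <= square_sum (fun i j => `|A i j|) N.
  by apply: ler_sum => i _; apply: ler_sum => j _; exact: ler_norm.
have [S1 [sq1 tr1 r1]] := double_series_ge0 (fun i j => normr_ge0 (A i j)) AB.
have [S2 [sq2 tr2 r2]] : exists S : R, [/\ square_sum P @ \oo --> S, triangle_sum P @ \oo --> S &
    forall r, (forall i, sums_to (P i) (r i)) -> sums_to r S].
  apply: (@double_series_ge0 _ P (B + B)) => // N; rewrite sqP.
  by have := AB N; have := sqA N; lra.
exists (S2 - S1); split.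
- rewrite (_ : square_sum A = fun N => square_sum P N - square_sum (fun i j => `|A i j|) N).
    exact: cvgB.
  by apply/funext => N; rewrite sqP addrAC subrr add0r.
- rewrite (_ : triangle_sum A = fun N => triangle_sum P N - triangle_sum (fun i j => `|A i j|) N).
    exact: cvgB.
  by apply/funext => N; rewrite trP addrAC subrr add0r.
move=> r rA.
have abs i : exists l, sums_to (fun j => `|A i j|) l.
  exists (limn (fun N => \sum_(j < N) `|A i j|)).
  apply: nondecreasing_is_cvgn.
    by move=> m n mn; apply: (ler_psum (a := fun j => `|A i j|)).
  exists B => _ [n _ <-]; apply: le_trans (AB (maxn i.+1 n)).
  rewrite /square_sum.
  have hi : (i < maxn i.+1 n)%N by rewrite leq_maxl.
  rewrite (bigD1 (Ordinal hi))//= ler_wpDr//.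
    by apply: sumr_ge0 => k _; exact: sumr_ge0.
  by apply: (ler_psum (a := fun j => `|A i j|)) => //; rewrite leq_maxr.
have [l Hl] := choice abs.
rewrite /sums_to (_ : (fun N => _) = (fun N => \sum_(i < N) (l i + r i) - \sum_(i < N) l i)).
  apply: cvgB; last exact: r1.
  apply: (r2 (fun i => l i + r i)) => i; rewrite /sums_to /P.
  under eq_fun do rewrite big_split/=.
  by apply: cvgD; [exact: Hl|exact: rA].
by apply/funext => N; rewrite big_split/= addrAC subrr add0r.
Qed.

(** * Substituting a power series in a double power series *)

Definition psum_to (R : realType) (a : nat -> R) (t x : R) : Prop :=
  sums_to (fun i => a i * t ^+ i) x.

(** A bound on the weighted l1 norm, stated on partial sums so that products are
    estimated with finite sums only. *)
Definition abs_bound (R : realType) (a : nat -> R) (r B : R) : Prop :=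
  forall N, \sum_(i < N) `|a i| * r ^+ i <= B.

Definition cauchy_mul (R : realType) (a b : nat -> R) : nat -> R :=
  fun n => \sum_(i < n.+1) a i * b (n - i)%N.

Fixpoint cauchy_exp (R : realType) (a : nat -> R) (k : nat) : nat -> R :=
  if k is k'.+1 then cauchy_mul (cauchy_exp a k') a else fun n => (n == 0%N)%:R.

Lemma sums_to_unique (R : realType) (a : nat -> R) (x y : R) :
  sums_to a x -> sums_to a y -> x = y.
Proof. by move=> ax ay; apply: (cvg_unique _ ax ay). Qed.

Lemma square_sumM (R : realType) (a b : nat -> R) (N : nat) :
  square_sum (fun i j => a i * b j) N = (\sum_(i < N) a i) * \sum_(j < N) b j.
Proof.
by rewrite mulr_suml; apply: eq_bigr => i _; rewrite mulr_sumr.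
Qed.

Lemma eq_triangle_sum (R : realType) (A : nat -> nat -> R) (f : nat -> R) (N : nat) :
  (forall n, \sum_(i < n.+1) A i (n - i)%N = f n) ->
  triangle_sum A N = \sum_(n < N) f n.
Proof. by move=> h; apply: eq_bigr => n _. Qed.

Lemma abs_bound_ge0 (R : realType) (a : nat -> R) (r B : R) :
  abs_bound a r B -> 0 <= B.
Proof. by move=> /(_ 0%N); rewrite big_ord0. Qed.

(** The weighted l1 norm is submultiplicative since a triangle lies inside the
    square of the same side. *)
Lemma abs_boundM (R : realType) (a b : nat -> R) (r A B : R) :
  0 <= r -> abs_bound a r A -> abs_bound b r B ->
  abs_bound (cauchy_mul a b) r (A * B).
Proof.
move=> r0 aA bB N.
pose C i j := (`|a i| * r ^+ i) * (`|b j| * r ^+ j).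
have C0 i j : 0 <= C i j by rewrite !mulr_ge0 ?exprn_ge0.
apply: (@le_trans _ _ (triangle_sum C N)).
  apply: ler_sum => n _; rewrite -[r ^+ n]ger0_norm ?exprn_ge0// -normrM.
  rewrite /cauchy_mul mulr_suml; apply: le_trans (ler_norm_sum _ _ _) _.
  apply: ler_sum => i _; rewrite /C mulrACA -exprD (subnKC (leq_ord i)).
  by rewrite !normrM (ger0_norm (exprn_ge0 _ r0)).
apply: le_trans (triangle_le_square _ C0) _; rewrite square_sumM.
by apply: ler_pM => //; apply: sumr_ge0 => i _; rewrite mulr_ge0 ?exprn_ge0.
Qed.

Lemma abs_boundX (R : realType) (a : nat -> R) (r A : R) (k : nat) :
  0 <= r -> abs_bound a r A -> abs_bound (cauchy_exp a k) r (A ^+ k).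
Proof.
move=> r0 aA; elim: k => [|k IH] /=; last by rewrite exprSr; exact: abs_boundM.
move=> [|N]; first by rewrite big_ord0 ler01.
rewrite big_ord_recl/= normr1 mulr1 big1 ?addr0// => i _.
by rewrite normr0 mul0r.
Qed.

(** The square sums of the array a_i b_j t^(i+j) factor, and its triangle sums are the
    partial sums of the Cauchy product. *)
Lemma psumM (R : realType) (a b : nat -> R) (r A B t x y : R) :
  `|t| <= r -> abs_bound a r A -> abs_bound b r B ->
  psum_to a t x -> psum_to b t y -> psum_to (cauchy_mul a b) t (x * y).
Proof.
move=> tr aA bB ax by_.
have tle (c : nat -> R) C N : abs_bound c r C -> \sum_(i < N) `|c i * t ^+ i| <= C.
  move=> /(_ N); apply: le_trans; apply: ler_sum => i _.
  by rewrite normrM normrX ler_wpM2l// lerXn2r ?nnegrE// (le_trans _ tr).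
have [N|S [sq tr' _]] := @double_series R
  (fun i j => (a i * t ^+ i) * (b j * t ^+ j)) (A * B).
  rewrite (_ : square_sum _ _ =
     square_sum (fun i j => `|a i * t ^+ i| * `|b j * t ^+ j|) N).
    by rewrite square_sumM; apply: ler_pM; rewrite ?sumr_ge0// tle.
  by apply: eq_bigr => i _; apply: eq_bigr => j _; rewrite normrM.
have xyS : x * y = S.
  have e : square_sum (fun i j => (a i * t ^+ i) * (b j * t ^+ j)) =
      fun N => (\sum_(i < N) a i * t ^+ i) * (\sum_(j < N) b j * t ^+ j).
    by apply/funext => N; exact: square_sumM.
  by rewrite e in sq; exact: (cvg_unique _ (cvgM ax by_) sq).
rewrite xyS /psum_to /sums_to; move: tr'.
rewrite (_ : triangle_sum _ = fun N => \sum_(i < N) cauchy_mul a b i * t ^+ i)//.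
apply/funext => N.
apply: (eq_triangle_sum (f := fun n => cauchy_mul a b n * t ^+ n)) => n.
rewrite /cauchy_mul mulr_suml; apply: eq_bigr => i _.
by rewrite mulrACA -exprD (subnKC (leq_ord i)).
Qed.

Lemma psumX (R : realType) (a : nat -> R) (r A t x : R) (k : nat) :
  `|t| <= r -> abs_bound a r A -> psum_to a t x ->
  psum_to (cauchy_exp a k) t (x ^+ k).
Proof.
move=> tr aA ax; have r0 : 0 <= r by exact: le_trans tr.
elim: k => [|k IH] /=; last first.
  by rewrite exprSr; apply: psumM tr (abs_boundX k r0 aA) aA IH ax.
rewrite /psum_to /sums_to expr0; apply: cvg_near_cst.
exists 1%N => // -[//|N] _ /=.
by rewrite big_ord_recl/= mulr1 big1 ?addr0// => i _; rewrite mul0r.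
Qed.

(** The m-th coefficient of t^(-d) B_d(s t, t chi(t)), where B_d is the homogeneous
    part of degree d of the double series b. *)
Definition curve_row (R : realType) (b : nat -> nat -> R) (s : R)
    (chi : nat -> R) (d m : nat) : R :=
  \sum_(i < d.+1) b i (d - i)%N * s ^+ i * cauchy_exp chi (d - i) m.

(** The part of degree d contributes only from t^d on, so that each coefficient of the
    restriction to the curve t -> (s t, t chi(t)) is a finite sum. *)
Definition curve_coef (R : realType) (b : nat -> nat -> R) (s : R)
    (chi : nat -> R) (n : nat) : R :=
  \sum_(d < n.+1) curve_row b s chi d (n - d).

Lemma sums_toZ (R : realType) (a : nat -> R) (x c : R) :
  sums_to a x -> sums_to (fun i => c * a i) (c * x).
Proof.
move=> ax; rewrite /sums_to; under eq_fun do rewrite -mulr_sumr.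
by apply: cvgM; [exact: cvg_cst|exact: ax].
Qed.

Lemma sums_to_sum (R : realType) (a : nat -> nat -> R) (x : nat -> R) (n : nat) :
  (forall i, sums_to (a i) (x i)) ->
  sums_to (fun m => \sum_(i < n) a i m) (\sum_(i < n) x i).
Proof.
move=> ax; rewrite /sums_to; under eq_fun do rewrite exchange_big/=.
exact: (cvg_psum (f := fun i M => \sum_(j < M) a i j) ax).
Qed.

Lemma psum_to_le (R : realType) (a : nat -> R) (r A t x : R) :
  `|t| <= r -> abs_bound a r A -> psum_to a t x -> `|x| <= A.
Proof.
move=> tr aA ax; have nx := cvg_norm (FF := eventually_filter) ax.
rewrite -(cvg_lim (@Rhausdorff R) nx); apply: limr_le.
  by apply/cvg_ex; eexists; exact: nx.
apply: nearW => N; apply: le_trans (ler_norm_sum _ _ _) _.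
apply: le_trans (aA N); apply: ler_sum => i _.
by rewrite normrM normrX ler_wpM2l// lerXn2r ?nnegrE// (le_trans _ tr).
Qed.

(** Consider the array whose (d, m) entry is the coefficient of row d at t^m, times
    t^(d+m). Its triangle sums are the partial sums of the series in t, and its rows sum
    to the homogeneous parts of b at (s t, t y), so that summing the rows gives the
    triangle sums of b itself. The weighted l1 norm of chi dominates both arrays. *)
Lemma psum_curve (R : realType) (b : nat -> nat -> R) (s : R) (chi : nat -> R)
    (r D rho B t y : R) :
  0 < r -> abs_bound chi r D -> rho <= r -> `|t| <= rho ->
  (forall N, square_sum (fun i j => `|b i j| * (`|s| * rho) ^+ i * (rho * D) ^+ j) N <= B) ->
  psum_to chi t y ->
  exists S : R, square_sum (fun i j => b i j * (s * t) ^+ i * (t * y) ^+ j) @ \oo --> S /\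
    psum_to (curve_coef b s chi) t S.
Proof.
move=> r0 chiD rhor trho bB chiy.
have rho0 : 0 <= rho by exact: le_trans trho.
have tr : `|t| <= r by exact: le_trans trho rhor.
have D0 := abs_bound_ge0 chiD.
pose M i j := `|b i j| * (`|s| * rho) ^+ i * (rho * D) ^+ j.
have M0 i j : 0 <= M i j by rewrite !mulr_ge0 ?exprn_ge0 ?mulr_ge0.
have yD := psum_to_le tr chiD chiy.
pose C i j := b i j * (s * t) ^+ i * (t * y) ^+ j.
have CM i j : `|C i j| <= M i j.
  rewrite /C /M !normrM !normrX !normrM ler_pM ?mulr_ge0 ?exprn_ge0 ?mulr_ge0//.
    by rewrite ler_wpM2l// lerXn2r ?nnegrE ?mulr_ge0// ler_wpM2l.
  by rewrite lerXn2r ?nnegrE ?mulr_ge0// ler_pM.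
have [N|S [Csq Ctr _]] := @double_series R C B.
  apply: le_trans (bB N); apply: ler_sum => i _; apply: ler_sum => j _.
  exact: CM.
exists S; split; first exact: Csq.
pose A d m := curve_row b s chi d m * t ^+ (d + m).
have Arow d N : \sum_(m < N) `|A d m| <= \sum_(i < d.+1) M i (d - i)%N.
  pose G i m := `|b i (d - i)%N| * (`|s| * rho) ^+ i * rho ^+ (d - i) *
                (`|cauchy_exp chi (d - i) m| * r ^+ m).
  apply: (@le_trans _ _ (\sum_(m < N) \sum_(i < d.+1) G i m)).
    apply: ler_sum => m _; rewrite /A /curve_row mulr_suml.
    apply: le_trans (ler_norm_sum _ _ _) _; apply: ler_sum => i _.
    have -> : G i m = `|b i (d - i)%N| * `|s| ^+ i * `|cauchy_exp chi (d - i) m| *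
        (rho ^+ d * r ^+ m).
      have -> : rho ^+ d = rho ^+ i * rho ^+ (d - i).
        by rewrite -exprD (subnKC (leq_ord i)).
      by rewrite /G exprMn; ring.
    rewrite !normrM !normrX exprD ler_wpM2l ?mulr_ge0 ?exprn_ge0//.
    by rewrite ler_pM ?exprn_ge0// lerXn2r ?nnegrE// ltW.
  rewrite exchange_big/=; apply: ler_sum => i _; rewrite -mulr_sumr /M.
  rewrite [(rho * D) ^+ _]exprMn mulrA ler_wpM2l//.
    by rewrite !mulr_ge0 ?exprn_ge0// mulr_ge0.
  exact: (abs_boundX _ (ltW r0) chiD).
have [N|S' [_ Atr Ar]] := @double_series R A B.
  apply: le_trans (bB N); apply: le_trans (triangle_le_square _ M0).
  by apply: ler_sum => d _; exact: Arow.
have rowto d : sums_to (A d) (\sum_(i < d.+1) C i (d - i)%N).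
  pose c i := b i (d - i)%N * s ^+ i * t ^+ d.
  rewrite (_ : A d = fun m => \sum_(i < d.+1)
      c i * (cauchy_exp chi (d - i) m * t ^+ m)); last first.
    apply/funext => m; rewrite /A /curve_row mulr_suml; apply: eq_bigr => i _.
    by rewrite /c exprD; ring.
  rewrite (_ : \sum_(i < d.+1) _ = \sum_(i < d.+1) c i * y ^+ (d - i)); last first.
    apply: eq_bigr => i _; rewrite /c /C !exprMn.
    have -> : t ^+ d = t ^+ i * t ^+ (d - i).
      by rewrite -exprD (subnKC (leq_ord i)).
    by ring.
  apply: (@sums_to_sum _ (fun i m => c i * (cauchy_exp chi (d - i) m * t ^+ m))
      (fun i => c i * y ^+ (d - i))) => i.
  by apply: sums_toZ; exact: psumX tr chiD chiy.
have SS : S = S'.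
  have h := Ar (fun d => \sum_(i < d.+1) C i (d - i)%N) rowto.
  exact: (cvg_unique _ Ctr h).
rewrite SS /psum_to /sums_to; move: Atr.
rewrite (_ : triangle_sum _ = fun N => \sum_(i < N) curve_coef b s chi i * t ^+ i)//.
apply/funext => N.
apply: (eq_triangle_sum (f := fun n => curve_coef b s chi n * t ^+ n)) => n.
rewrite /curve_coef mulr_suml; apply: eq_bigr => i _.
by rewrite /A (subnKC (leq_ord i)).
Qed.

(** * Zeros of power series and the identity theorem *)

Lemma psum_to_pseries (R : realType) (a : nat -> R) (t x : R) :
  pseries a t @ \oo --> x <-> psum_to a t x.
Proof.
rewrite /psum_to /sums_to /pseries.
by rewrite seriesEord.
Qed.

Lemma sum_half_powers (R : realType) (N : nat) :
  \sum_(i < N) (2^-1 : R) ^+ i <= 2.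
Proof.
suff -> : \sum_(i < N) (2^-1 : R) ^+ i = 2 - 2 * 2^-1 ^+ N.
  by rewrite gerBl mulr_ge0// exprn_ge0.
elim: N => [|N IH]; first by rewrite big_ord0 expr0; ring.
by rewrite big_ord_recr/= IH exprS; field.
Qed.

Lemma abs_bound_of_terms (R : realType) (a : nat -> R) (r A : R) :
  0 <= r -> (forall i, `|a i| * r ^+ i <= A) -> abs_bound a (r / 2) (A * 2).
Proof.
move=> r0 aA N; have A0 : 0 <= A by apply: le_trans (aA 0%N); rewrite mulr_ge0 ?exprn_ge0.
apply: (@le_trans _ _ (\sum_(i < N) A * 2^-1 ^+ i)).
  by apply: ler_sum => i _; rewrite exprMn mulrA ler_wpM2r ?exprn_ge0.
by rewrite -mulr_sumr ler_wpM2l// sum_half_powers.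
Qed.

Lemma psum_terms_bounded (R : realType) (a : nat -> R) (t x : R) :
  psum_to a t x -> exists A, forall i, `|a i| * `|t| ^+ i <= A.
Proof.
move=> ax.
have /cvg_seq_bounded/pinfty_ex_gt0[M M0 /= HM] :
    cvgn (fun N => \sum_(i < N) a i * t ^+ i) by apply/cvg_ex; exists x.
exists (M + M) => i; rewrite -normrX -normrM.
have -> : a i * t ^+ i = \sum_(j < i.+1) a j * t ^+ j - \sum_(j < i) a j * t ^+ j.
  by rewrite big_ord_recr/= addrAC subrr add0r.
by apply: le_trans (ler_normB _ _) _; apply: lerD; exact: HM.
Qed.

Lemma abs_bound_of_psum (R : realType) (a : nat -> R) (t x : R) :
  psum_to a t x -> exists A, abs_bound a (`|t| / 2) A.
Proof.
move=> /psum_terms_bounded[A HA]; exists (A * 2).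
exact: abs_bound_of_terms.
Qed.

Lemma psum_tail (R : realType) (z : nat -> R) (r A t x : R) (m : nat) :
  0 < r -> abs_bound z r A -> `|t| <= r -> (forall i, (i < m)%N -> z i = 0) ->
  psum_to z t x -> `|x - z m * t ^+ m| <= A * (`|t| / r) ^+ m.+1.
Proof.
move=> r0 zA tr z0 zx.
have cx : (fun N => `|\sum_(i < N) z i * t ^+ i - z m * t ^+ m|) @ \oo -->
    `|x - z m * t ^+ m|.
  by apply: cvg_norm; apply: cvgB; [exact: zx|exact: cvg_cst].
rewrite -(cvg_lim (@Rhausdorff R) cx); apply: limr_le.
  by apply/cvg_ex; eexists; exact: cx.
exists m.+1 => // N /= mN.
rewrite (bigD1 (Ordinal mN))//= addrAC subrr add0r.
apply: le_trans (ler_norm_sum _ _ _) _.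
have q0 : 0 <= `|t| / r by rewrite divr_ge0// ltW.
have q1 : `|t| / r <= 1 by rewrite ler_pdivrMr// mul1r.
apply: (@le_trans _ _ (\sum_(i < N) `|z i| * r ^+ i * (`|t| / r) ^+ m.+1)); last first.
  by rewrite -mulr_suml ler_wpM2r// exprn_ge0.
rewrite big_mkcond/=; apply: ler_sum => i _.
have rhs0 : 0 <= `|z i| * r ^+ i * (`|t| / r) ^+ m.+1.
  by rewrite !mulr_ge0 ?exprn_ge0 // ltW.
case: ifPn => // im; have [lim|mi] := ltnP i m; first by apply: le_trans rhs0; rewrite z0// mul0r normr0.
rewrite normrM normrX -mulrA ler_wpM2l//.
have -> : `|t| ^+ i = r ^+ i * (`|t| / r) ^+ i.
  by rewrite -exprMn mulrC divfK// gt_eqF.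
rewrite ler_wpM2l ?exprn_ge0 ?(ltW r0)// ler_wiXn2l// ltn_neqAle mi andbT.
by apply: contraNneq im => mi'; apply/eqP; apply: val_inj; rewrite /= mi'.
Qed.

(** Inductively, the first coefficient that could be nonzero dominates the sum, hence is
    O(t). Smallness is asked only at points accumulating at the centre: the lemma then gives
    the uniqueness of asymptotic expansions on one side as well as isolated zeros. *)
Lemma coef_eq0_of_small (R : realType) (z : nat -> R) (r A K : R) (n : nat) :
  0 < r -> abs_bound z r A ->
  (forall e, 0 < e -> exists t x, [/\ 0 < `|t|, `|t| < e, psum_to z t x &
     `|x| <= K * `|t| ^+ n.+1]) ->
  forall m, (m <= n)%N -> z m = 0.
Proof.
move=> r0 zA small; elim/ltn_ind => m IH mn.
have A0 := abs_bound_ge0 zA.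
have z0 i : (i < m)%N -> z i = 0 by move=> im; apply: IH => //; lia.
apply/eqP; rewrite -normr_le0; apply/ler_addgt0Pl => e e0; rewrite addr0.
(* K bounds the sum and A / r^(m+1) the tail; the last 1 makes L positive. *)
pose L := `|K| + A / r ^+ m.+1 + 1.
have L0 : 0 < L by rewrite ltr_pwDr// addr_ge0// divr_ge0// exprn_ge0// (ltW r0).
have [t [x [t0 te zx xK]]] : exists t x, [/\ 0 < `|t|, `|t| < Num.min (Num.min 1 r) (e / L), psum_to z t x &
     `|x| <= K * `|t| ^+ n.+1].
  by apply: small; rewrite !lt_min ltr01 r0 divr_gt0.
move: te; rewrite !lt_min => /andP[/andP[t1 tr] teL].
have := psum_tail r0 zA (ltW tr) z0 zx.
rewrite exprMn exprVn => h.
have tm : 0 < `|t| ^+ m by rewrite exprn_gt0.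
have h1 : `|t| ^+ n.+1 <= `|t| ^+ m.+1 by rewrite ler_wiXn2l// (ltW t1).
have h2 : `|z m| * `|t| ^+ m <= L * `|t| * `|t| ^+ m.
  rewrite -normrX -normrM.
  have h3 : `|z m * t ^+ m| <= `|x| + `|x - z m * t ^+ m|.
    rewrite -[X in `|X| <= _](subKr x); exact: ler_normB.
  apply: (le_trans h3); rewrite normrX -mulrA -exprS.
  have h4 : K * `|t| ^+ n.+1 <= `|K| * `|t| ^+ m.+1.
    apply: (@le_trans _ _ (`|K| * `|t| ^+ n.+1)).
      by rewrite ler_wpM2r ?exprn_ge0// ler_norm.
    by rewrite ler_wpM2l.
  have h5 : 0 <= `|t| ^+ m.+1 by rewrite exprn_ge0.
  have h6 : A * (`|t| ^+ m.+1 / r ^+ m.+1) = A / r ^+ m.+1 * `|t| ^+ m.+1.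
    by rewrite mulrAC mulrA.
  rewrite h6 in h; rewrite /L !mulrDl mul1r; lra.
move: h2; rewrite ler_pM2r// => /le_trans; apply.
by rewrite ltW// mulrC -ltr_pdivlMr.
Qed.

(** The points near which g vanishes form a relatively open subset of J. It is also
    relatively closed: at a limit point zeros of g accumulate, so that the power series
    there is zero. An interval being connected, this subset is all of J. *)
Lemma analytic_eq0 (R : realType) (J : set R) (g : R -> R) (t1 : R) :
  is_interval J -> analytic_on_itv J g -> J t1 ->
  (exists2 e, 0 < e & forall t, J t -> `|t - t1| < e -> g t = 0) ->
  forall t, J t -> g t = 0.
Proof.
move=> /connected_intervalP cJ ang Jt1 g1.
pose C : set R := [set t | exists2 e, 0 < e & forall t', J t' -> `|t' - t| < e -> g t' = 0].
suff JC : J `&` C = J.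
  move=> t Jt; have [_ [e e0 he]] : (J `&` C) t by rewrite JC.
  by apply: he => //; rewrite subrr normr0.
apply: cJ; first by exists t1.
  exists C => //; rewrite openE => t [e e0 he]; apply/nbhs_ballP.
  exists (e / 2); first by rewrite /= divr_gt0.
  move=> s; rewrite /ball /= => ts; exists (e / 2); first by rewrite divr_gt0.
  move=> t' Jt' t's; apply: he => //.
  have -> : t' - t = (t' - s) - (t - s) by ring.
  by apply: le_lt_trans (ler_normB _ _) _; lra.
exists (closure (J `&` C)); first exact: closed_closure.
apply/seteqP; split; first by move=> t JCt; split; [case: JCt|exact: subset_closure].
move=> t [Jt clt]; split => //.
have [//|nCt] := pselect (C t).
have near e : 0 < e -> exists b, [/\ J b, C b & 0 < `|b - t| < e].
  move=> e0; have [b [[Jb Cb] tb]] := clt _ (nbhsx_ballx t e e0).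
  exists b; split => //; rewrite distrC; move: tb; rewrite /ball /= => ->.
  rewrite andbT normr_gt0 subr_eq0; apply/eqP => tb; apply: nCt.
  by rewrite tb.
have [a [r [r0 ha]]] := ang t Jt.
have [b0 [Jb0 _ /andP[b00 b0r]]] := near r r0.
have /psum_to_pseries sb0 := ha _ Jb0 b0r.
have [A aA] := abs_bound_of_psum sb0.
have a0 n : a n = 0.
  apply: (coef_eq0_of_small (r := `|b0 - t| / 2) (K := 0) _ aA) (leqnn n) => //.
    by rewrite divr_gt0.
  move=> e e0.
  have [|b [Jb [e' e'0 Cb] /andP[b0' be]]] := near (Num.min e r).
    by rewrite lt_min e0.
  move: be; rewrite lt_min => /andP[be br].
  exists (b - t), 0; split => //; last by rewrite normr0 mul0r.
  rewrite -(Cb b Jb); last by rewrite subrr normr0.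
  by apply/psum_to_pseries; exact: ha.
exists r => // t' Jt' t'r; have /psum_to_pseries := ha _ Jt' t'r.
rewrite /psum_to => h; apply: (sums_to_unique h); rewrite /sums_to.
rewrite (_ : (fun N => _) = cst 0); first exact: cvg_cst.
by apply/funext => N; apply: big1 => i _; rewrite a0 mul0r.
Qed.

(** * Analytic functions of two variables along a curve *)

Definition square_seq (N : nat) : seq (nat * nat) :=
  [seq (i, j) | i <- index_iota 0 N, j <- index_iota 0 N].

Lemma mem_square_seq (N : nat) (jk : nat * nat) :
  (jk \in square_seq N) = (jk.1 < N)%N && (jk.2 < N)%N.
Proof.
case: jk => j k /=; apply/allpairsP/andP => [[[i l] /= []]|[jN kN]].
  by rewrite !mem_index_iota /= => ? ? [-> ->].
by exists (j, k); rewrite !mem_index_iota.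
Qed.

Lemma fsbig_square (R : realType) (A : nat -> nat -> R) (N : nat) :
  (\sum_(jk \in [set` square_seq N]) `|(A jk.1 jk.2)%:E| =
   (square_sum (fun i j => `|A i j|) N)%:E)%E.
Proof.
rewrite -fsbig_seq; last first.
  by apply: allpairs_uniq; rewrite ?iota_uniq// => -[a b] [c d] _ _ [-> ->].
transitivity (\sum_(jk <- square_seq N) (`|A jk.1 jk.2|%R)%:E)%E.
  by apply: eq_bigr.
rewrite sumEFin; congr EFin.
rewrite /square_seq big_allpairs_dep/= big_mkord /square_sum.
by apply: eq_bigr => i _; rewrite big_mkord.
Qed.

Lemma square_sum_bounded (R : realType) (A : nat -> nat -> R) :
  summable [set: nat * nat] (fun jk => (A jk.1 jk.2)%:E) ->
  exists B, forall N, square_sum (fun i j => `|A i j|) N <= B.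
Proof.
rewrite summableE => h.
exists (fine (\esum_(jk in [set: nat * nat]) `|(A jk.1 jk.2)%:E|)%E).
move=> N; rewrite -lee_fin fineK// -fsbig_square.
apply: esum_ge; exists [set` square_seq N] => //.
by split => //; exact: finite_seq.
Qed.

Lemma summable_of_square_bound (R : realType) (A : nat -> nat -> R) (B : R) :
  (forall N, square_sum (fun i j => `|A i j|) N <= B) ->
  summable [set: nat * nat] (fun jk => (A jk.1 jk.2)%:E).
Proof.
move=> AB; rewrite /summable; apply: (@le_lt_trans _ _ B%:E); last exact: ltry.
apply: ub_ereal_sup => _ [X [Xfin _] <-].
have [N XN] : exists N, forall jk, X jk -> (jk.1 < N)%N && (jk.2 < N)%N.
  have /finite_seqP[s sX] := Xfin.
  exists (\max_(jk <- s) (maxn jk.1 jk.2)).+1 => jk; rewrite sX /= => js.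
  rewrite !ltnS -geq_max.
  exact: (leq_bigmax_seq (F := fun jk : nat * nat => maxn jk.1 jk.2) (P := xpredT) jk js).
apply: (@le_trans _ _ (square_sum (fun i j => `|A i j|) N)%:E).
  rewrite -fsbig_square; apply: lee_fsum_nneg_subset => //.
    exact: finite_seq.
  move=> jk /set_mem Xjk; apply/mem_set => /=.
  by rewrite mem_square_seq; exact: XN.
by rewrite lee_fin.
Qed.

(** Absolute convergence at the one point p + (r/2, r/2) bounds all the square sums. *)
Lemma analytic_at_bound (R : realType) (F : R * R -> R) (p : R * R) :
  analytic_at F p -> exists (b : nat -> nat -> R) (r B : R),
   [/\ 0 < r, forall N, square_sum (fun i j => `|b i j| * r ^+ i * r ^+ j) N <= B &
    forall q, `|q.1 - p.1| <= r -> `|q.2 - p.2| <= r ->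
      square_sum (fun i j => b i j * (q.1 - p.1) ^+ i * (q.2 - p.2) ^+ j) @ \oo --> F q].
Proof.
move=> [b [r [r0 Hb]]].
have h0 : 0 < r / 2 by rewrite divr_gt0.
have h1 : r / 2 < r by lra.
have hp : `|(p.1 + r / 2) - p.1| < r by rewrite addrAC subrr add0r gtr0_norm.
have hp' : `|(p.2 + r / 2) - p.2| < r by rewrite addrAC subrr add0r gtr0_norm.
have [sb _] := Hb (p.1 + r / 2, p.2 + r / 2) hp hp'.
have [B HB] := @square_sum_bounded _ (fun i j => b i j * (p.1 + r / 2 - p.1) ^+ i * (p.2 + r / 2 - p.2) ^+ j) sb.
exists b, (r / 2), B; split => //; last first.
  move=> q q1 q2; have [|| _ h] := Hb q; [exact: le_lt_trans h1|exact: le_lt_trans h1|].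
  exact: h.
move=> N; apply: le_trans (HB N); apply: ler_sum => i _; apply: ler_sum => j _.
rewrite [p.1 + _ - _]addrAC [p.2 + _ - _]addrAC !subrr !add0r.
by rewrite !normrM !(ger0_norm (exprn_ge0 _ (ltW h0))).
Qed.

Lemma square_sum_le (R : realType) (A C : nat -> nat -> R) (N : nat) :
  (forall i j, A i j <= C i j) -> square_sum A N <= square_sum C N.
Proof. by move=> h; apply: ler_sum => i _; apply: ler_sum. Qed.

(** The curve t -> p + (s t, t chi(t)) stays in the square of convergence around p for
    small t, because chi is bounded there. *)
Lemma analytic_along_curve (R : realType) (F : R * R -> R) (p : R * R)
    (s r D : R) (chi : nat -> R) :
  analytic_at F p -> 0 < r -> abs_bound chi r D ->
  exists (c : nat -> R) (rho : R), 0 < rho /\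
    forall t y, `|t| <= rho -> psum_to chi t y ->
      psum_to c t (F (p.1 + s * t, p.2 + t * y)).
Proof.
move=> /analytic_at_bound[b [r' [B [r'0 HB HF]]]] r0 chiD.
have D0 := abs_bound_ge0 chiD.
pose rho := Num.min r (Num.min (r' / (`|s| + 1)) (r' / (D + 1))).
have s1 : 0 < `|s| + 1 by rewrite ltr_wpDl.
have D1 : 0 < D + 1 by rewrite ltr_wpDl.
have rho0 : 0 < rho by rewrite /rho !lt_min r0 !divr_gt0.
have rhor : rho <= r by rewrite /rho ge_min lexx.
have rhos : `|s| * rho <= r'.
  have : rho <= r' / (`|s| + 1) by rewrite /rho !ge_min lexx orbT.
  rewrite ler_pdivlMr// mulrDr mulr1; lra.
have rhoD : rho * D <= r'.
  have : rho <= r' / (D + 1) by rewrite /rho !ge_min lexx !orbT.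
  rewrite ler_pdivlMr// mulrDr mulr1; lra.
exists (curve_coef b s chi), rho; split => // t y trho chiy.
have yD := psum_to_le (le_trans trho rhor) chiD chiy.
have [N|S [sS cS]] := psum_curve (s := s) (b := b) (B := B) r0 chiD rhor trho _ chiy.
  apply: le_trans (HB N); apply: square_sum_le => i j.
  rewrite ler_pM ?mulr_ge0 ?exprn_ge0 ?mulr_ge0 ?(ltW rho0)//.
    by rewrite ler_wpM2l// lerXn2r ?nnegrE ?mulr_ge0 ?(ltW rho0) ?(ltW r'0).
  by rewrite lerXn2r ?nnegrE ?mulr_ge0 ?(ltW rho0) ?(ltW r'0).
have := HF (p.1 + s * t, p.2 + t * y) => /=.
rewrite [p.1 + _ - _]addrAC [p.2 + _ - _]addrAC !subrr !add0r !normrM.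
have h1 : `|s| * `|t| <= r' by apply: le_trans rhos; rewrite ler_wpM2l.
have h2 : `|t| * `|y| <= r' by apply: le_trans rhoD; rewrite ler_pM.
by move=> /(_ h1 h2) h; rewrite (cvg_unique _ h sS).
Qed.

(** * Recentring a double power series *)

Lemma psum_ex (R : realType) (a : nat -> R) (r A t : R) :
  abs_bound a r A -> `|t| <= r -> exists x, psum_to a t x.
Proof.
move=> aA tr.
have c : cvgn (series (fun i => a i * t ^+ i)).
  apply: normed_cvg.
  have -> : [normed series (fun i => a i * t ^+ i)] =
      fun N => \sum_(i < N) `|a i * t ^+ i|.
    by apply/funext => N; rewrite /= /series/= big_mkord.
  apply: nondecreasing_is_cvgn.
    by move=> m n mn; apply: (ler_psum (a := fun i => `|a i * t ^+ i|)).
  exists A => _ [N _ <-]; apply: le_trans (aA N); apply: ler_sum => i _.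
  by rewrite normrM normrX ler_wpM2l// lerXn2r ?nnegrE// (le_trans _ tr).
exists (limn (series (fun i => a i * t ^+ i))).
by apply/psum_to_pseries.
Qed.

Definition geom_bound (R : realType) (a : nat -> nat -> R) (r A : R) : Prop :=
  forall i j, `|a i j| * r ^+ i * r ^+ j <= A.

Definition dpow (R : realType) (a : nat -> nat -> R) (x y : R) : nat -> nat -> R :=
  fun i j => a i j * x ^+ i * y ^+ j.

Lemma square_half_powers (R : realType) (A : R) (C : nat -> nat -> R) (N : nat) :
  0 <= A -> (forall i j, `|C i j| <= A * 2^-1 ^+ i * 2^-1 ^+ j) ->
  square_sum (fun i j => `|C i j|) N <= A * 4.
Proof.
move=> A0 h.
apply: (@le_trans _ _ (square_sum (fun i j => (A * 2^-1 ^+ i) * 2^-1 ^+ j) N)).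
  exact: square_sum_le.
rewrite square_sumM -mulr_sumr -mulrA ler_wpM2l//.
have -> : 4 = 2 * 2 :> R by ring.
have h0 : 0 <= \sum_(i < N) (2^-1 : R) ^+ i by apply: sumr_ge0 => i _; rewrite exprn_ge0.
by apply: ler_pM => //; exact: sum_half_powers.
Qed.

Lemma geom_bound_ge0 (R : realType) (a : nat -> nat -> R) (r A : R) :
  geom_bound a r A -> 0 <= A.
Proof. by move=> /(_ 0%N 0%N); rewrite !expr0 !mulr1; apply: le_trans. Qed.

Lemma dpow_le (R : realType) (a : nat -> nat -> R) (r A x y : R) :
  0 <= r -> geom_bound a r A -> `|x| <= r / 2 -> `|y| <= r / 2 ->
  forall i j, `|dpow a x y i j| <= A * 2^-1 ^+ i * 2^-1 ^+ j.
Proof.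
move=> r0 aA xr yr i j; rewrite /dpow !normrM !normrX.
apply: (@le_trans _ _ (`|a i j| * (r / 2) ^+ i * (r / 2) ^+ j)).
  by rewrite ler_pM ?mulr_ge0 ?exprn_ge0// ?ler_wpM2l// lerXn2r ?nnegrE ?divr_ge0.
rewrite !exprMn.
have -> : `|a i j| * (r ^+ i * 2^-1 ^+ i) * (r ^+ j * 2^-1 ^+ j) =
  `|a i j| * r ^+ i * r ^+ j * (2^-1 ^+ i * 2^-1 ^+ j) by ring.
by rewrite -(mulrA A) ler_wpM2r// mulr_ge0 ?exprn_ge0.
Qed.

Lemma dpow_cvg (R : realType) (a : nat -> nat -> R) (r A x y : R) :
  0 <= r -> geom_bound a r A -> `|x| <= r / 2 -> `|y| <= r / 2 ->
  exists S : R, square_sum (dpow a x y) @ \oo --> S.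
Proof.
move=> r0 aA xr yr.
have [N|S [sS _ _]] := @double_series R (dpow a x y) (A * 4); last by exists S.
apply: square_half_powers; first exact: geom_bound_ge0 aA.
exact: dpow_le aA xr yr.
Qed.

Definition recenter (R : realType) (c : nat -> R) (p : R) (j : nat) : R :=
  limn (fun N => \sum_(n < N) c (j + n)%N *+ 'C(j + n, j) * p ^+ n).

Lemma bin_le_exp2 (n k : nat) : ('C(n, k) <= 2 ^ n)%N.
Proof.
have [nk|kn] := ltnP n k; first by rewrite bin_small.
have -> : (2 ^ n = \sum_(i < n.+1) 'C(n, i))%N.
  rewrite -[2%N]/(1 + 1)%N expnDn; apply: eq_bigr => i _.
  by rewrite !exp1n !muln1.
by rewrite (bigD1 (Ordinal (kn : (k < n.+1)%N)))//= leq_addr.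
Qed.

(** The binomial coefficient costs at most 2^(j+n): the factor 2^j is absorbed by halving
    the radius, the factor 2^n by taking p within a quarter of it. *)
Lemma recenter_term_le (R : realType) (c : nat -> R) (r A p : R) (j n : nat) :
  0 < r -> (forall i, `|c i| * r ^+ i <= A) -> `|p| <= r / 4 ->
  `|c (j + n)%N *+ 'C(j + n, j)| * `|p| ^+ n * (r / 2) ^+ j <= A * 2^-1 ^+ n.
Proof.
move=> r0 cA pr; rewrite normrMn.
apply: (@le_trans _ _ ((`|c (j + n)%N| * 2 ^+ (j + n)) * (r / 4) ^+ n * (r / 2) ^+ j)).
  rewrite ler_wpM2r ?exprn_ge0 ?divr_ge0 ?(ltW r0)//.
  rewrite ler_pM ?mulrn_wge0 ?exprn_ge0//.
    by rewrite -[leLHS]mulr_natr ler_wpM2l// -natrX ler_nat bin_le_exp2.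
  by rewrite lerXn2r ?nnegrE ?divr_ge0 ?(ltW r0).
have -> : (r / 4) ^+ n = r ^+ n * 2^-1 ^+ n * 2^-1 ^+ n.
  by rewrite -!exprMn; congr (_ ^+ _); field.
have e k : 2 ^+ k * 2^-1 ^+ k = 1 :> R by rewrite -exprMn divff ?expr1n.
have -> : `|c (j + n)%N| * 2 ^+ (j + n) * (r ^+ n * 2^-1 ^+ n * 2^-1 ^+ n) * (r / 2) ^+ j
  = `|c (j + n)%N| * r ^+ (j + n) * 2^-1 ^+ n * (2 ^+ j * 2^-1 ^+ j) * (2 ^+ n * 2^-1 ^+ n).
  by rewrite !exprD exprMn; ring.
by rewrite !e !mulr1 ler_wpM2r// exprn_ge0.
Qed.

Lemma recenter_psum (R : realType) (c : nat -> R) (r A p : R) (j : nat) :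
  0 < r -> (forall i, `|c i| * r ^+ i <= A) -> `|p| <= r / 4 ->
  sums_to (fun n => c (j + n)%N *+ 'C(j + n, j) * p ^+ n) (recenter c p j) /\
  `|recenter c p j| * (r / 2) ^+ j <= A * 2.
Proof.
move=> r0 cA pr; pose d n := c (j + n)%N *+ 'C(j + n, j).
have r20 : 0 < (r / 2) ^+ j by rewrite exprn_gt0// divr_gt0.
have dA : abs_bound d `|p| (A * 2 / (r / 2) ^+ j).
  move=> N; rewrite ler_pdivlMr// mulr_suml.
  apply: (@le_trans _ _ (\sum_(i < N) A * 2^-1 ^+ i)).
    by apply: ler_sum => n _; exact: recenter_term_le.
  rewrite -mulr_sumr ler_wpM2l ?sum_half_powers//.
  by apply: le_trans (cA 0%N); rewrite mulr_ge0 ?exprn_ge0 ?(ltW r0).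
have [x dx] := psum_ex dA (lexx _).
have -> : recenter c p j = x by apply: cvg_lim => //; exact: dx.
split; first exact: dx.
by rewrite -ler_pdivlMr//; exact: psum_to_le (lexx _) dA dx.
Qed.

(** The antidiagonals of the array c_(j+n) binom(j+n, j) p^n h^j are the binomial
    expansions of the c_m (p + h)^m, and its rows sum to the recentred terms. *)
Lemma psum_recenter (R : realType) (c : nat -> R) (r A p h x : R) :
  0 < r -> (forall i, `|c i| * r ^+ i <= A) -> `|p| <= r / 4 -> `|h| <= r / 4 ->
  psum_to c (p + h) x -> psum_to (recenter c p) h x.
Proof.
move=> r0 cA pr hr cx.
have A0 : 0 <= A by apply: le_trans (cA 0%N); rewrite mulr_ge0 ?exprn_ge0 ?(ltW r0).
pose T j n := c (j + n)%N *+ 'C(j + n, j) * p ^+ n * h ^+ j.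
have [N|S [_ Ttr Trow]] := @double_series R T (A * 4).
  apply: square_half_powers => // j n; rewrite /T !normrM !normrX.
  apply: (@le_trans _ _ (`|c (j + n)%N *+ 'C(j + n, j)| * `|p| ^+ n * ((r / 2) ^+ j * 2^-1 ^+ j))).
    rewrite ler_wpM2l ?mulr_ge0 ?exprn_ge0// -exprMn.
    by rewrite lerXn2r ?nnegrE ?mulr_ge0 ?(ltW r0)//; lra.
  by rewrite [leLHS]mulrA [leRHS]mulrAC ler_wpM2r ?exprn_ge0//; exact: recenter_term_le.
have e : triangle_sum T = fun N => \sum_(i < N) c i * (p + h) ^+ i.
  apply/funext => N; apply: (eq_triangle_sum (f := fun n => c n * (p + h) ^+ n)) => n.
  rewrite exprDn mulr_sumr; apply: eq_bigr => i _; rewrite /T (subnKC (leq_ord i)).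
  by rewrite -[c n *+ _]mulr_natr -[_ *+ 'C(n, i)]mulr_natr; ring.
have Sx : S = x by rewrite e in Ttr; exact: (cvg_unique _ Ttr cx).
rewrite -Sx; apply: (Trow (fun j => recenter c p j * h ^+ j)) => j.
have [h1 _] := recenter_psum j r0 cA pr.
have := sums_toZ (c := h ^+ j) h1; rewrite /sums_to mulrC.
rewrite (_ : (fun N => _) = (fun N => \sum_(i < N) T j i))//.
by apply/funext => N; apply: eq_bigr => n _; rewrite mulrC.
Qed.

Definition flip2 (R : realType) (a : nat -> nat -> R) : nat -> nat -> R :=
  fun i j => a j i.

Lemma square_sum_flip (R : realType) (a : nat -> nat -> R) :
  square_sum (flip2 a) = square_sum a.
Proof. by apply/funext => N; rewrite /square_sum exchange_big. Qed.

Lemma dpow_flip (R : realType) (a : nat -> nat -> R) (x y : R) :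
  dpow (flip2 a) y x = flip2 (dpow a x y).
Proof.
by apply/funext => i; apply/funext => j; rewrite /dpow /flip2 mulrAC.
Qed.

Lemma geom_bound_flip (R : realType) (a : nat -> nat -> R) (r A : R) :
  geom_bound a r A -> geom_bound (flip2 a) r A.
Proof. by move=> h i j; rewrite mulrAC; exact: h. Qed.

Lemma geom_bound_col (R : realType) (a : nat -> nat -> R) (r A : R) (k i : nat) :
  0 < r -> geom_bound a r A -> `|a i k| * r ^+ i <= A / r ^+ k.
Proof. by move=> r0 h; rewrite ler_pdivlMr ?exprn_gt0. Qed.

Lemma dpow_iterated (R : realType) (a : nat -> nat -> R) (r A x y S : R) (X : nat -> R) :
  0 <= r -> geom_bound a r A -> `|x| <= r / 2 -> `|y| <= r / 2 ->
  (forall k, psum_to (fun n => a n k) x (X k)) ->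
  square_sum (dpow a x y) @ \oo --> S -> psum_to X y S.
Proof.
move=> r0 aA xr yr aX aS.
have [N|S' [sS' _ hS']] := @double_series R (flip2 (dpow a x y)) (A * 4).
  rewrite -dpow_flip; apply: square_half_powers; first exact: geom_bound_ge0 aA.
  by apply: dpow_le (geom_bound_flip aA) _ _.
rewrite square_sum_flip in sS'.
rewrite (cvg_unique _ aS sS') //.
apply: (hS' (fun k => X k * y ^+ k)) => k; rewrite mulrC.
have := sums_toZ (c := y ^+ k) (aX k).
rewrite /sums_to (_ : (fun N => _) = (fun N => \sum_(i < N) flip2 (dpow a x y) k i))//.
by apply/funext => N; apply: eq_bigr => n _; rewrite /flip2 /dpow mulrC.
Qed.

Definition shift1 (R : realType) (a : nat -> nat -> R) (p : R) : nat -> nat -> R :=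
  fun j k => recenter (fun n => a n k) p j.

Lemma geom_bound_shift1 (R : realType) (a : nat -> nat -> R) (r A p : R) :
  0 < r -> geom_bound a r A -> `|p| <= r / 4 ->
  geom_bound (shift1 a p) (r / 2) (A * 2).
Proof.
move=> r0 aA pr j k.
have [_ h] := recenter_psum j r0 (fun i => geom_bound_col k i r0 aA) pr.
have A0 := geom_bound_ge0 aA.
have rk : 0 < r ^+ k by rewrite exprn_gt0.
apply: (@le_trans _ _ (A / r ^+ k * 2 * (r / 2) ^+ k)).
  by rewrite ler_wpM2r// exprn_ge0// divr_ge0// ltW.
rewrite exprMn.
have -> : A / r ^+ k * 2 * (r ^+ k * 2^-1 ^+ k) = A * 2 * 2^-1 ^+ k.
  by field; rewrite gt_eqF.
by rewrite ler_piMr ?mulr_ge0//; apply: exprn_ile1 => //; lra.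
Qed.

(** Summing over the first index first, for each fixed power of y, reduces the claim to
    recentring in one variable. *)
Lemma shift1_cvg (R : realType) (a : nat -> nat -> R) (r A p h y S : R) :
  0 < r -> geom_bound a r A -> `|p| <= r / 4 -> `|h| <= r / 4 -> `|y| <= r / 4 ->
  square_sum (dpow a (p + h) y) @ \oo --> S ->
  square_sum (dpow (shift1 a p) h y) @ \oo --> S.
Proof.
move=> r0 aA pr hr yr aS.
have phr : `|p + h| <= r / 2 by have := ler_normD p h; lra.
have yr2 : `|y| <= r / 2 by lra.
have r20 : 0 <= r / 2 by lra.
have hr2 : `|h| <= r / 2 / 2 by lra.
have yr4 : `|y| <= r / 2 / 2 by lra.
have cA k i : `|a i k| * r ^+ i <= A / r ^+ k by exact: geom_bound_col.
have ex k : exists x, psum_to (fun n => a n k) (p + h) x.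
  by apply: psum_ex phr; apply: abs_bound_of_terms (ltW r0) _; exact: cA.
have [X HX] := choice ex.
have XS := dpow_iterated (ltW r0) aA phr yr2 HX aS.
have sA := geom_bound_shift1 r0 aA pr.
have [S' HS'] := dpow_cvg r20 sA hr2 yr4.
have X' k : psum_to (fun n => shift1 a p n k) h (X k).
  exact: psum_recenter r0 (cA k) pr hr (HX k).
have XS' := dpow_iterated r20 sA hr2 yr4 X' HS'.
have e : S = S' by exact: sums_to_unique XS XS'.
rewrite e; exact: HS'.
Qed.

Definition dsum (R : realType) (a : nat -> nat -> R) (q : R * R) : R :=
  limn (square_sum (dpow a q.1 q.2)).

Lemma dsum_cvg (R : realType) (a : nat -> nat -> R) (r A : R) (q : R * R) :
  0 <= r -> geom_bound a r A -> `|q.1| <= r / 2 -> `|q.2| <= r / 2 ->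
  square_sum (dpow a q.1 q.2) @ \oo --> dsum a q.
Proof.
move=> r0 aA q1 q2; have [S HS] := dpow_cvg r0 aA q1 q2.
by rewrite /dsum (cvg_lim _ HS).
Qed.

(** One variable is recentred at a time, transposing the array in between; each step
    halves the radius. *)
Lemma dsum_analytic (R : realType) (a : nat -> nat -> R) (r A : R) (p : R * R) :
  0 < r -> geom_bound a r A -> `|p.1| <= r / 8 -> `|p.2| <= r / 8 ->
  analytic_at (dsum a) p.
Proof.
move=> r0 aA p1 p2.
have p14 : `|p.1| <= r / 4 by lra.
have r20 : 0 < r / 2 by lra.
have p24 : `|p.2| <= r / 2 / 4 by lra.
have g1 := geom_bound_flip (geom_bound_shift1 r0 aA p14).
have g2 := geom_bound_flip (geom_bound_shift1 r20 g1 p24).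
set b := flip2 _ in g2.
(* Two recentrings leave the radius r / 4, and b is summed within half of it. *)
exists b, (r / 8); split; first by lra.
move=> q q1 q2.
have h1 : `|q.1 - p.1| <= r / 2 / 2 / 2 by lra.
have h2 : `|q.2 - p.2| <= r / 2 / 2 / 2 by lra.
split.
  apply: (summable_of_square_bound (A := dpow b (q.1 - p.1) (q.2 - p.2)) (B := A * 2 * 2 * 4)) => N.
  apply: square_half_powers; first exact: geom_bound_ge0 g2.
  by apply: dpow_le g2 h1 h2; lra.
have e1 : `|q.1| <= r / 2 by have := ler_normD p.1 (q.1 - p.1); rewrite subrKC; lra.
have e2 : `|q.2| <= r / 4 by have := ler_normD p.2 (q.2 - p.2); rewrite subrKC; lra.
have e22 : `|q.2| <= r / 2 by lra.
have cF := dsum_cvg (ltW r0) aA e1 e22.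
have k1 : `|q.1 - p.1| <= r / 4 by lra.
have := @shift1_cvg _ _ _ _ p.1 (q.1 - p.1) _ _ r0 aA p14 k1 e2.
rewrite subrKC => /(_ _ cF).
rewrite -square_sum_flip -dpow_flip => c1.
have k2 : `|q.2 - p.2| <= r / 2 / 4 by lra.
have k3 : `|q.1 - p.1| <= r / 2 / 4 by lra.
have := @shift1_cvg _ _ _ _ p.2 (q.2 - p.2) _ _ r20 g1 p24 k2 k3.
rewrite subrKC => /(_ _ c1).
by rewrite -square_sum_flip -dpow_flip.
Qed.

(** * Taylor expansion in two variables *)

Definition dfst (R : realType) (u : R * R -> R) : R * R -> R := fun p => 'D_(1, 0) u p.
Definition dsnd (R : realType) (u : R * R -> R) : R * R -> R := fun p => 'D_(0, 1) u p.

(** The y-derivatives are taken first. In this order the coefficients of dsnd u are shifts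
    of those of u, and so are those of dfst u on the x-axis, which is all that the remainder
    estimate uses; mixed derivatives never have to be exchanged. *)
Definition taylor_coef (R : realType) (u : R * R -> R) (j k : nat) : R :=
  iter j (@dfst R) (iter k (@dsnd R) u) (0, 0) / (j`! * k`!)%:R.

Lemma is_derive_snd (R : realType) (u : R * R -> R) (x y : R) :
  derivable u (x, y) (0, 1) -> is_derive y 1 (fun z => u (x, z)) (dsnd u (x, y)).
Proof.
have e : (fun h : R => h^-1 *: (((fun z => u (x, z)) \o shift y) (h *: (1 : R)) - u (x, y)))
  = (fun h : R => h^-1 *: ((u \o shift (x, y)) (h *: ((0, 1) : R * R)) - u (x, y))).
  apply/funext => h /=; congr (_ *: (u _ - _)).
  by rewrite -[h *: (0, 1)]/(h * 0, h * 1) -[RHS]/(h * 0 + x, h * 1 + y) mulr0 add0r.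
move=> du; apply: DeriveDef; first by rewrite /derivable e.
by rewrite /derive e.
Qed.

Lemma is_derive_fst (R : realType) (u : R * R -> R) (x y : R) :
  derivable u (x, y) (1, 0) -> is_derive x 1 (fun z => u (z, y)) (dfst u (x, y)).
Proof.
have e : (fun h : R => h^-1 *: (((fun z => u (z, y)) \o shift x) (h *: (1 : R)) - u (x, y)))
  = (fun h : R => h^-1 *: ((u \o shift (x, y)) (h *: ((1, 0) : R * R)) - u (x, y))).
  apply/funext => h /=; congr (_ *: (u _ - _)).
  by rewrite -[h *: (1, 0)]/(h * 1, h * 0) -[RHS]/(h * 1 + x, h * 0 + y) mulr0 add0r.
move=> du; apply: DeriveDef; first by rewrite /derivable e.
by rewrite /derive e.
Qed.

Lemma mvt_bound (R : realType) (g dg : R -> R) (M d y : R) :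
  `|y| <= d -> (forall z : R, `|z| <= `|y| -> is_derive z (1 : R) g (dg z)) ->
  (forall z : R, `|z| <= `|y| -> `|dg z| <= M) ->
  `|g y - g 0| <= M * `|y|.
Proof.
move=> yd gd gM.
have key a b : a <= b -> `|a| <= `|y| -> `|b| <= `|y| -> `|b - a| <= `|y| ->
    `|g b - g a| <= M * `|y|.
  move=> ab ay by_ bay.
  have inn z : z \in `[a, b]%R -> `|z| <= `|y|.
    rewrite in_itv /= => /andP[az zb]; rewrite ler_norml.
    move: ay by_; rewrite !ler_norml => /andP[? _] /andP[_ ?].
    by apply/andP; split; lra.
  have [||c cab ->] := @MVT_segment R g dg a b ab.
  - by move=> z zab; apply: gd; apply: inn; exact: subset_itv_oo_cc zab.
  - apply: derivable_within_continuous => z zab.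
    by have := gd z (inn z zab); move=> /@ex_derive.
  have M0 : 0 <= M by apply: le_trans (gM c (inn c cab)).
  by rewrite normrM ler_pM// gM// inn.
have [y0|/ltW y0] := leP 0 y.
  by apply: key => //; rewrite ?normr0 ?subr0.
by rewrite distrC; apply: key => //; rewrite ?normr0 ?sub0r ?normrN.
Qed.

Definition taylor_sum (R : realType) (u : R * R -> R) (N : nat) (x y : R) : R :=
  triangle_sum (dpow (taylor_coef u) x y) N.

Lemma taylor_coef_snd (R : realType) (u : R * R -> R) (j k : nat) :
  taylor_coef (dsnd u) j k = taylor_coef u j k.+1 *+ k.+1.
Proof.
rewrite /taylor_coef -iterSr factS -[RHS]mulr_natr !natrM; field.
by rewrite nat1r !pnatr_eq0 -!lt0n ?fact_gt0.
Qed.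

Lemma taylor_coef_fst (R : realType) (u : R * R -> R) (j : nat) :
  taylor_coef (dfst u) j 0 = taylor_coef u j.+1 0 *+ j.+1.
Proof.
rewrite /taylor_coef /= -iterSr/= factS -[RHS]mulr_natr !natrM; field.
by rewrite nat1r !pnatr_eq0 -!lt0n ?fact_gt0.
Qed.

Lemma deriv_ord_sum (R : nzRingType) (n : nat) (F : 'I_n -> {poly R}) :
  (\sum_(i < n) F i)^`() = \sum_(i < n) (F i)^`().
Proof. exact: raddf_sum. Qed.

Lemma is_derive_taylor_snd (R : realType) (u : R * R -> R) (N : nat) (x y : R) :
  is_derive y 1 (fun z => taylor_sum u N.+1 x z) (taylor_sum (dsnd u) N x y).
Proof.
(* For fixed x the Taylor sum is a polynomial in its second variable. *)
pose p : {poly R} := \sum_(d < N.+1) \sum_(i < d.+1)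
   (taylor_coef u i (d - i)%N * x ^+ i) *: 'X^(d - i).
have -> : (fun z => taylor_sum u N.+1 x z) = horner p.
  apply/funext => z; rewrite /taylor_sum /triangle_sum horner_sum.
  apply: eq_bigr => d _; rewrite horner_sum; apply: eq_bigr => i _.
  by rewrite hornerZ hornerXn.
have -> : taylor_sum (dsnd u) N x y = p^`().[y]; last exact: is_derive_poly.
rewrite /p deriv_ord_sum horner_sum big_ord_recl/= [X in _ = X + _](_ : _ = 0) ?add0r; last first.
  by rewrite deriv_ord_sum horner_sum big1// => i _; rewrite ?sub0n ?expr0 derivZ derivC scaler0 horner0.
apply: eq_bigr => d _; rewrite /bump leq0n add1n deriv_ord_sum horner_sum [RHS]big_ord_recr/=.
rewrite subnn expr0 derivZ derivC scaler0 horner0 addr0.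
apply: eq_bigr => i _; rewrite derivZ derivXn hornerZ hornerMn hornerXn.
rewrite (subSn (leq_ord i)) /dpow taylor_coef_snd/=.
by rewrite -[in LHS]mulr_natr -[in RHS]mulr_natr; ring.
Qed.

Lemma taylor_sum_axis (R : realType) (u : R * R -> R) (N : nat) (x : R) :
  taylor_sum u N x 0 = \sum_(d < N) taylor_coef u d 0 * x ^+ d.
Proof.
apply: eq_bigr => d _; rewrite big_ord_recr/= subnn /dpow expr0 mulr1.
rewrite big1 ?add0r// => i _; rewrite expr0n.
by rewrite (_ : (d - i == 0)%N = false) ?mulr0//; have := ltn_ord i; lia.
Qed.

Lemma is_derive_taylor_fst (R : realType) (u : R * R -> R) (N : nat) (x : R) :
  is_derive x 1 (fun z => taylor_sum u N.+1 z 0) (taylor_sum (dfst u) N x 0).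
Proof.
pose p : {poly R} := \sum_(d < N.+1) taylor_coef u d 0 *: 'X^d.
have -> : (fun z => taylor_sum u N.+1 z 0) = horner p.
  apply/funext => z; rewrite taylor_sum_axis horner_sum.
  by apply: eq_bigr => d _; rewrite hornerZ hornerXn.
have -> : taylor_sum (dfst u) N x 0 = p^`().[x]; last exact: is_derive_poly.
rewrite /p deriv_ord_sum horner_sum big_ord_recl/= expr0 derivZ derivC scaler0.
rewrite horner0 add0r taylor_sum_axis; apply: eq_bigr => d _.
rewrite /bump leq0n add1n derivZ derivXn hornerZ hornerMn hornerXn taylor_coef_fst/=.
by rewrite -[in LHS]mulr_natr -[in RHS]mulr_natr; ring.
Qed.

Lemma taylor_sum00 (R : realType) (u : R * R -> R) (N : nat) :
  taylor_sum u N.+1 0 0 = u (0, 0).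
Proof.
rewrite taylor_sum_axis big_ord_recl big1 ?addr0; last first.
  by move=> i _; rewrite expr0n mulr0.
by rewrite expr0 mulr1 /taylor_coef/= fact0 divr1.
Qed.

(** Induction on the order: go from the origin to (x, 0) and then to (x, y). On each
    segment the mean value theorem reduces the estimate to the previous order, for dfst u
    on the axis and for dsnd u. *)
Lemma taylor_remainder (R : realType) (Om : set (R * R)) (d0 : R) (n : nat)
    (u : R * R -> R) :
  0 < d0 -> (forall x y, `|x| <= d0 -> `|y| <= d0 -> Om (x, y)) -> Ck n Om u ->
  exists M d, [/\ 0 < d, d <= d0 & forall x y, `|x| <= d -> `|y| <= d ->
    `|u (x, y) - taylor_sum u n x y| <= M * (`|x| + `|y|) ^+ n].
Proof.
move=> d00 box; have Om0 : Om (0, 0) by apply: box; rewrite normr0 ltW.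
elim: n u => [|n IH] u.
  move=> [uc _]; have := uc _ Om0.
  move=> /cvgrPdist_le/(_ 1 ltr01)/nbhs_ballP[e /= e0 he].
  exists (`|u (0, 0)| + 1), (Num.min (e / 2) d0).
  split; [by rewrite lt_min d00 divr_gt0|by rewrite ge_min lexx orbT|].
  move=> x y; rewrite !le_min => /andP[xe _] /andP[ye _].
  rewrite expr0 mulr1 /taylor_sum /triangle_sum big_ord0 subr0.
  have : `|u (0, 0) - u (x, y)| <= 1.
    by apply: he; split; rewrite /ball/= sub0r normrN; lra.
  have := ler_normB (u (0, 0)) (u (0, 0) - u (x, y)); rewrite subKr; lra.
move=> /= [uc [du d1u d2u]].
have [M1 [e1 [e10 e1d h1]]] := IH _ d1u.
have [M2 [e2 [e20 e2d h2]]] := IH _ d2u.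
exists (`|M1| + `|M2|), (Num.min e1 e2); split.
- by rewrite lt_min e10.
- by rewrite ge_min e1d.
move=> x y; rewrite !le_min => /andP[x1 x2] /andP[y1 y2].
pose v x y := u (x, y) - taylor_sum u n.+1 x y.
have r0 : 0 <= `|x| + `|y| by rewrite addr_ge0.
have hy : `|v x y - v x 0| <= `|M2| * (`|x| + `|y|) ^+ n * `|y|.
  apply: (mvt_bound (dg := fun z => dsnd u (x, z) - taylor_sum (dsnd u) n x z) (lexx _)) => z zy.
    have z0 : `|z| <= d0 by lra.
    have xd : `|x| <= d0 by lra.
    have [_ dz] := du _ (box _ _ xd z0).
    by apply: is_deriveB; [exact: is_derive_snd|exact: is_derive_taylor_snd].
  have z2 : `|z| <= e2 by lra.
  apply: le_trans (h2 x z x2 z2) _.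
  apply: (@le_trans _ _ (`|M2| * (`|x| + `|z|) ^+ n)).
    by rewrite ler_wpM2r ?ler_norm// exprn_ge0// addr_ge0.
  by rewrite ler_wpM2l// lerXn2r ?nnegrE ?addr_ge0// lerD2l.
have hx : `|v x 0 - v 0 0| <= `|M1| * (`|x| + `|y|) ^+ n * `|x|.
  apply: (mvt_bound (g := fun z => v z 0)
    (dg := fun z => dfst u (z, 0) - taylor_sum (dfst u) n z 0) (lexx _)) => z zx.
    have z0 : `|z| <= d0 by lra.
    have nd : `|0 : R| <= d0 by rewrite normr0 ltW.
    have [dz _] := du _ (box _ _ z0 nd).
    by apply: is_deriveB; [exact: is_derive_fst|exact: is_derive_taylor_fst].
  have z1 : `|z| <= e1 by lra.
  have n1 : `|0 : R| <= e1 by rewrite normr0 ltW.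
  apply: le_trans (h1 z 0 z1 n1) _; rewrite normr0 addr0.
  apply: (@le_trans _ _ (`|M1| * `|z| ^+ n)).
    by rewrite ler_wpM2r ?ler_norm// exprn_ge0.
  rewrite ler_wpM2l// lerXn2r ?nnegrE ?addr_ge0//; have := normr_ge0 y; lra.
have v00 : v 0 0 = 0 by rewrite /v taylor_sum00 subrr.
rewrite v00 subr0 in hx.
have -> : u (x, y) - taylor_sum u n.+1 x y = (v x y - v x 0) + v x 0 by rewrite subrK.
apply: le_trans (ler_normD _ _) _; apply: le_trans (lerD hy hx) _.
rewrite exprSr mulrDl.
have P0 : 0 <= (`|x| + `|y|) ^+ n by rewrite exprn_ge0.
have := mulr_ge0 (mulr_ge0 (normr_ge0 M1) P0) (normr_ge0 y).
have := mulr_ge0 (mulr_ge0 (normr_ge0 M2) P0) (normr_ge0 x).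
rewrite !mulrDr !mulrA; lra.
Qed.

(** * Taylor expansion along the dilated curves *)

Lemma exists_near_in_itv (R : realType) (I : set R) (t0 r : R) :
  is_interval I -> (exists a b, [/\ I a, I b & a < b]) -> I t0 -> 0 < r ->
  exists t1, [/\ I t1, 0 < `|t1 - t0| & `|t1 - t0| < r].
Proof.
move=> itvI [a [b [Ia Ib ab]]] It0 r0.
have [tb|bt] := ltP t0 b.
  have [h|h] := leP b (t0 + r / 2).
    exists b; split => //; first by rewrite normr_gt0 subr_eq0 gt_eqF.
    by rewrite gtr0_norm ?subr_gt0//; lra.
  exists (t0 + r / 2); have -> : t0 + r / 2 - t0 = r / 2 by ring.
  rewrite gtr0_norm ?divr_gt0//; split; [|lra|lra].
  by apply: (itvI t0 b) => //; apply/andP; split; lra.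
have [h|h] := leP (t0 - r / 2) a.
  have at0 : a < t0 by lra.
  exists a; split=> //; first by rewrite normr_gt0 subr_eq0 lt_eqF.
  by rewrite distrC gtr0_norm ?subr_gt0//; lra.
exists (t0 - r / 2); have -> : t0 - r / 2 - t0 = - (r / 2) by ring.
rewrite normrN gtr0_norm ?divr_gt0//; split; [|lra|lra].
by apply: (itvI a t0) => //; apply/andP; split; lra.
Qed.

Lemma psum_to_unique (R : realType) (a : nat -> R) (t x y : R) :
  psum_to a t x -> psum_to a t y -> x = y.
Proof. exact: sums_to_unique. Qed.

Lemma psum_shift (R : realType) (a : nat -> R) (t y : R) :
  psum_to (fun n => a n.+1) t y -> psum_to a t (a 0%N + t * y).
Proof.
move=> h; rewrite /psum_to /sums_to -(cvg_shiftS (fun N => \sum_(i < N) a i * t ^+ i)).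
rewrite (_ : [sequence _]_n = fun N => a 0%N + t * \sum_(i < N) a i.+1 * t ^+ i).
  by apply: cvgD; [exact: cvg_cst|apply: cvgM; [exact: cvg_cst|exact: h]].
apply/funext => N /=; rewrite big_ord_recl expr0 mulr1; congr (_ + _).
by rewrite mulr_sumr; apply: eq_bigr => i _; rewrite lift0 exprS; ring.
Qed.

Lemma abs_bound_shift (R : realType) (a : nat -> R) (r A : R) :
  0 < r -> abs_bound a r A -> abs_bound (fun n => a n.+1) r (A / r).
Proof.
move=> r0 aA N; rewrite ler_pdivlMr// mulr_suml; apply: le_trans (aA N.+1).
rewrite big_ord_recl/= ler_wpDl//; first by rewrite mulr_ge0 ?exprn_ge0// ltW.
by apply: ler_sum => i _; rewrite -mulrA -exprSr /bump leq0n add1n.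
Qed.

Lemma psum_to0 (R : realType) (a : nat -> R) : psum_to a 0 (a 0%N).
Proof.
rewrite /psum_to /sums_to; apply: cvg_near_cst; exists 1%N => // -[//|N] _ /=.
by rewrite big_ord_recl big1 ?addr0 ?mulr1// => i _; rewrite expr0n mulr0.
Qed.

(** At an endpoint of I the given series represents phi on one side only, but its
    convergence at a single other point already bounds its coefficients geometrically. *)
Lemma local_factor (R : realType) (I : set R) (phi : R -> R) (t0 : R) :
  is_interval I -> (exists a b, [/\ I a, I b & a < b]) ->
  analytic_on_itv I phi -> I t0 ->
  exists (chi : nat -> R) (r D : R), [/\ 0 < r, abs_bound chi r D &
    forall t, I t -> `|t - t0| <= r ->
      exists2 y, psum_to chi (t - t0) y & phi t = phi t0 + (t - t0) * y].
Proof.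
move=> itvI ndI anI It0; have [a [r [r0 ha]]] := anI t0 It0.
have [t1 [It1 t10 t1r]] := exists_near_in_itv itvI ndI It0 r0.
have /psum_to_pseries p1 := ha _ It1 t1r.
have [A aA] := abs_bound_of_psum p1.
have r1 : 0 < `|t1 - t0| / 2 by rewrite divr_gt0.
exists (fun n => a n.+1), (`|t1 - t0| / 2), (A / (`|t1 - t0| / 2)).
split => //; first exact: abs_bound_shift.
move=> t It tr; have [y hy] := psum_ex (abs_bound_shift r1 aA) tr; exists y => //.
have trr : `|t - t0| < r by lra.
have /psum_to_pseries pt := ha _ It trr.
have a0 : a 0%N = phi t0.
  have tt : `|t0 - t0| < r by rewrite subrr normr0.
  have /psum_to_pseries := ha _ It0 tt; rewrite subrr => h.
  exact: psum_to_unique (@psum_to0 _ a) h.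
by rewrite -a0; exact: psum_to_unique pt (psum_shift hy).
Qed.

Lemma abs_boundZ (R : realType) (a : nat -> R) (r A s : R) :
  abs_bound a r A -> abs_bound (fun n => s * a n) r (`|s| * A).
Proof.
move=> aA N; apply: le_trans (ler_wpM2l (normr_ge0 s) (aA N)).
by rewrite mulr_sumr; apply: ler_sum => i _; rewrite normrM mulrA.
Qed.

Lemma psum_toZ (R : realType) (a : nat -> R) (t x s : R) :
  psum_to a t x -> psum_to (fun n => s * a n) t (s * x).
Proof.
move=> h; have := sums_toZ (c := s) h; rewrite /psum_to /sums_to.
by rewrite (_ : (fun N => _) = (fun N => \sum_(i < N) s * a i * t ^+ i))//;
  apply/funext => N; apply: eq_bigr => i _; rewrite mulrA.
Qed.

Lemma psum_toB (R : realType) (a b : nat -> R) (t x y : R) :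
  psum_to a t x -> psum_to b t y -> psum_to (fun n => a n - b n) t (x - y).
Proof.
move=> ha hb; rewrite /psum_to /sums_to.
rewrite (_ : (fun N => _) = (fun N => \sum_(i < N) a i * t ^+ i - \sum_(i < N) b i * t ^+ i)).
  by apply: cvgB; [exact: ha|exact: hb].
by apply/funext => N; rewrite -sumrB; apply: eq_bigr => i _; rewrite mulrBl.
Qed.

Lemma exists_small (R : realType) (A B eps : R) : 0 <= A -> 0 <= B -> 0 < eps ->
  exists rho, [/\ 0 < rho, A * rho <= eps & rho * B <= eps].
Proof.
move=> A0 B0 e0; exists (Num.min (eps / (A + 1)) (eps / (B + 1))).
have A1 : 0 < A + 1 by lra.
have B1 : 0 < B + 1 by lra.
split; first by rewrite lt_min !divr_gt0.
  have : Num.min (eps / (A + 1)) (eps / (B + 1)) <= eps / (A + 1) by rewrite ge_min lexx.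
  have : 0 < Num.min (eps / (A + 1)) (eps / (B + 1)) by rewrite lt_min !divr_gt0.
  by rewrite ler_pdivlMr// mulrDr mulr1; lra.
have : Num.min (eps / (A + 1)) (eps / (B + 1)) <= eps / (B + 1) by rewrite ge_min lexx orbT.
have : 0 < Num.min (eps / (A + 1)) (eps / (B + 1)) by rewrite lt_min !divr_gt0.
by rewrite ler_pdivlMr// mulrDr mulr1; lra.
Qed.

Lemma dsum_along_curve (R : realType) (a : nat -> nat -> R) (r0 A s r D : R)
    (chi : nat -> R) :
  0 < r0 -> geom_bound a r0 A -> 0 < r -> abs_bound chi r D ->
  exists rho : R, [/\ 0 < rho, rho <= r & forall t y, `|t| <= rho -> psum_to chi t y ->
    [/\ `|s * t| <= r0 / 2, `|t * y| <= r0 / 2 &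
      psum_to (curve_coef a s chi) t (dsum a (s * t, t * y))]].
Proof.
move=> r00 aA rp chiD; have D0 := abs_bound_ge0 chiD.
have r02 : 0 < r0 / 2 by rewrite divr_gt0.
have [rho1 [rho10 h1 h2]] := exists_small (normr_ge0 s) D0 r02.
pose rho := Num.min r rho1.
have rho0 : 0 < rho by rewrite lt_min rp.
have rhor : rho <= r by rewrite ge_min lexx.
have rho1r : rho <= rho1 by rewrite ge_min lexx orbT.
have k1 : `|s| * rho <= r0 / 2 by apply: le_trans h1; rewrite ler_wpM2l.
have k2 : rho * D <= r0 / 2 by apply: le_trans h2; rewrite ler_wpM2r.
exists rho; split => // t y trho chiy.
have yD := psum_to_le (le_trans trho rhor) chiD chiy.
have st : `|s * t| <= r0 / 2.
  by rewrite normrM; apply: le_trans k1; rewrite ler_wpM2l.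
have ty : `|t * y| <= r0 / 2.
  by rewrite normrM; apply: le_trans k2; rewrite ler_pM.
split => //.
have [N|S [sS cS]] := psum_curve (s := s) (b := a) (B := A * 4) rp chiD rhor trho _ chiy.
  have := @square_half_powers R A (dpow a (`|s| * rho) (rho * D)) N (geom_bound_ge0 aA).
  move=> /(_ (dpow_le (ltW r00) aA _ _)); rewrite !normrM !normr_id !(ger0_norm (ltW rho0)) (ger0_norm D0).
  move=> /(_ k1 k2); apply: le_trans; apply: square_sum_le => i j.
  by rewrite /dpow !normrM !normrX !normrM normr_id (ger0_norm (ltW rho0)) (ger0_norm D0).
have := dsum_cvg (q := (s * t, t * y)) (ltW r00) aA st ty.
by move=> h; rewrite (cvg_unique (@Rhausdorff R) h sS).
Qed.

(** A Taylor polynomial seen as a double power series, so that its restriction to a curve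
    is given by the same formula as for a full series. *)
Definition truncate (R : realType) (n : nat) (a : nat -> nat -> R) : nat -> nat -> R :=
  fun i j => if (i + j <= n)%N then a i j else 0.

Lemma truncate_geom (R : realType) (n : nat) (a : nat -> nat -> R) :
  geom_bound (truncate n a) 1 (square_sum (fun i j => `|a i j|) n.+1).
Proof.
move=> i j; rewrite !expr1n !mulr1 /truncate; case: ifPn => ij; last first.
  by rewrite normr0; apply: sumr_ge0 => k _; exact: sumr_ge0.
have hi : (i < n.+1)%N by lia.
have hj : (j < n.+1)%N by lia.
rewrite /square_sum (bigD1 (Ordinal hi))//= (bigD1 (Ordinal hj))//= -addrA lerDl.
by rewrite addr_ge0//; apply: sumr_ge0 => k _ //; exact: sumr_ge0.
Qed.

Lemma dsum_truncate (R : realType) (n : nat) (a : nat -> nat -> R) (x y : R) :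
  `|x| <= 1 / 2 -> `|y| <= 1 / 2 ->
  dsum (truncate n a) (x, y) = triangle_sum (dpow a x y) n.+1.
Proof.
move=> x1 y1; have g := truncate_geom n a.
have h := dsum_cvg (q := (x, y)) ler01 g x1 y1.
have [N|S [sS tS _]] := @double_series R (dpow (truncate n a) x y) (square_sum (fun i j => `|a i j|) n.+1 * 4).
  by apply: square_half_powers (geom_bound_ge0 g) _; exact: dpow_le ler01 g x1 y1.
rewrite (cvg_unique (@Rhausdorff R) h sS).
suff tn : triangle_sum (dpow (truncate n a) x y) @ \oo --> triangle_sum (dpow a x y) n.+1.
  exact: (cvg_unique _ tS tn).
apply: cvg_near_cst; exists n.+1 => // N /= nN.
rewrite -(subnKC nN) /triangle_sum big_split_ord/= [X in _ + X]big1 ?addr0.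
  apply: eq_bigr => d _; apply: eq_bigr => i _; rewrite /dpow /truncate.
  by rewrite (subnKC (leq_ord i)) (leq_ord d).
move=> d _; apply: big1 => i _; rewrite /dpow /truncate (subnKC (leq_ord i)).
have f : (n.+1 + d <= n)%N = false by lia.
by rewrite f !mul0r.
Qed.

Lemma curve_coef_truncate (R : realType) (n m : nat) (a : nat -> nat -> R) (s : R)
    (chi : nat -> R) : (m <= n)%N ->
  curve_coef (truncate n a) s chi m = curve_coef a s chi m.
Proof.
move=> mn; apply: eq_bigr => d _; apply: eq_bigr => i _; rewrite /truncate.
by rewrite (subnKC (leq_ord i)) (leq_trans (leq_ord d) mn).
Qed.

(** On the curve u is G, so it has some expansion in t; it is also a Taylor polynomial of
    order n up to O(t^(n+1)), whose coefficients up to t^n are the claimed ones. The two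
    expansions coincide up to order n, for every n. *)
Lemma taylor_along_curve (R : realType) (Om : set (R * R)) (d0 : R)
    (u G : R * R -> R) (I : set R) (phi : R -> R) (psi : nat -> R) (r D s : R) :
  0 < d0 -> (forall x y, `|x| <= d0 -> `|y| <= d0 -> Om (x, y)) ->
  (forall k, Ck k Om u) ->
  is_interval I -> (exists a b, [/\ I a, I b & a < b]) -> I 0 ->
  0 < r -> abs_bound psi r D ->
  (forall t, I t -> `|t| <= r -> exists2 y, psum_to psi t y & phi t = t * y) ->
  analytic_at G (0, 0) ->
  (exists2 e, 0 < e & forall t, I t -> `|t| < e -> u (s * t, s * phi t) = G (s * t, s * phi t)) ->
  exists2 rho, 0 < rho & forall t, I t -> `|t| <= rho ->
    psum_to (curve_coef (taylor_coef u) s (fun n => s * psi n)) t (u (s * t, s * phi t)).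
Proof.
move=> d00 box smooth itvI ndI I0 r0 psiD phiE anG [e e0 uG].
have D0 := abs_bound_ge0 psiD.
have chiD := abs_boundZ s psiD.
have [c [rho1 [rho10 Hc]]] := analytic_along_curve s anG r0 chiD.
pose rho := Num.min (Num.min r (e / 2)) rho1.
have rho0 : 0 < rho by rewrite !lt_min r0 rho10 divr_gt0.
have uc t : I t -> `|t| <= rho -> psum_to c t (u (s * t, s * phi t)).
  move=> It; rewrite !le_min => /andP[/andP[tr te] trho].
  have [y psiy phity] := phiE t It tr.
  have := Hc t (s * y) trho (psum_toZ (s := s) psiy); rewrite /= !add0r uG//; last by lra.
  by rewrite phity mulrCA.
exists rho => // t It trho.
suff -> : curve_coef (taylor_coef u) s (fun n => s * psi n) = c by exact: uc.
apply/funext => n.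
pose a := taylor_coef u; pose chi := fun n => s * psi n.
have [rho2 [rho20 rho2r Htr]] := dsum_along_curve s ltr01 (truncate_geom n a) r0 chiD.
have [M [d [d_gt0 dd0 HM]]] := taylor_remainder d00 box (smooth n.+1).
have sD0 : 0 <= `|s| * D by rewrite mulr_ge0.
(* Up to rho3 the point (s t, s phi(t)) stays in the box of the Taylor estimate. *)
have [rho3 [rho30 s3 D3]] := exists_small (normr_ge0 s) sD0 d_gt0.
pose z n' := c n' - curve_coef (truncate n a) s chi n'.
have small t' : I t' -> `|t'| <= Num.min rho (Num.min rho2 rho3) ->
    exists2 x, psum_to z t' x & `|x| <= `|M| * (`|s| + `|s| * D) ^+ n.+1 * `|t'| ^+ n.+1.
  move=> It'; rewrite le_min => /andP[t'rho]; rewrite le_min => /andP[t'2 t'3].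
  have t'r : `|t'| <= r by exact: le_trans rho2r.
  have [y psiy phity] := phiE t' It' t'r.
  have [h1 h2 h3] := Htr t' (s * y) t'2 (psum_toZ (s := s) psiy).
  exists (u (s * t', s * phi t') - dsum (truncate n a) (s * t', t' * (s * y))).
    exact: (psum_toB (uc t' It' t'rho) h3).
  rewrite dsum_truncate// phity [s * (t' * y)]mulrCA.
  have yD := psum_to_le t'r psiD psiy.
  have k1 : `|s * t'| <= d by rewrite normrM; apply: le_trans s3; rewrite ler_wpM2l.
  have k2 : `|t' * (s * y)| <= `|t'| * (`|s| * D).
    by rewrite !normrM ler_wpM2l// ler_wpM2l.
  have k3 : `|t' * (s * y)| <= d.
    by apply: le_trans k2 _; apply: le_trans D3; rewrite ler_wpM2r.
  apply: le_trans (HM _ _ k1 k3) _; rewrite -mulrA -exprMn.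
  apply: (@le_trans _ _ (`|M| * (`|s * t'| + `|t' * (s * y)|) ^+ n.+1)).
    by rewrite ler_wpM2r ?ler_norm// exprn_ge0// addr_ge0.
  rewrite ler_wpM2l// lerXn2r ?nnegrE ?addr_ge0 ?mulr_ge0 ?addr_ge0 ?mulr_ge0//.
  by rewrite mulrDl (normrM s) lerD2l [leRHS]mulrC.
have m0 : 0 < Num.min rho (Num.min rho2 rho3) by rewrite lt_min rho0 lt_min rho20.
have [t1 [It1]] := exists_near_in_itv itvI ndI I0 m0; rewrite subr0 => t10 t1m.
have [x1 zx1 _] := small t1 It1 (ltW t1m).
have [A zA] := abs_bound_of_psum zx1.
have t12 : 0 < `|t1| / 2 by rewrite divr_gt0.
have zn : z n = 0.
  apply: (coef_eq0_of_small (K := `|M| * (`|s| + `|s| * D) ^+ n.+1) t12 zA) (leqnn n).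
  move=> eps eps0.
  have mm0 : 0 < Num.min eps (Num.min rho (Num.min rho2 rho3)) by rewrite lt_min eps0.
  have [t2 [It2]] := exists_near_in_itv itvI ndI I0 mm0; rewrite subr0 lt_min => t20 /andP[t2e t2m].
  have [x zx xle] := small t2 It2 (ltW t2m).
  by exists t2, x.
by move/eqP: zn; rewrite /z subr_eq0 curve_coef_truncate// => /eqP.
Qed.

Lemma cauchy_expZ (R : realType) (s : R) (psi : nat -> R) (k m : nat) :
  cauchy_exp (fun n => s * psi n) k m = s ^+ k * cauchy_exp psi k m.
Proof.
elim: k m => [|k IH] m /=; first by rewrite expr0 mul1r.
rewrite /cauchy_mul mulr_sumr; apply: eq_bigr => i _.
by rewrite IH exprSr; ring.
Qed.

Lemma curve_rowZ (R : realType) (a : nat -> nat -> R) (s : R) (psi : nat -> R) (d m : nat) :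
  curve_row a s (fun n => s * psi n) d m = s ^+ d * curve_row a 1 psi d m.
Proof.
rewrite /curve_row mulr_sumr; apply: eq_bigr => i _.
rewrite cauchy_expZ expr1n mulr1.
have -> : s ^+ d = s ^+ i * s ^+ (d - i) by rewrite -exprD (subnKC (leq_ord i)).
by ring.
Qed.

(** The coefficient of t^n along the s-th dilated curve, as a polynomial in s. *)
Definition slice_poly (R : realType) (a : nat -> nat -> R) (psi : nat -> R) (n : nat) : {poly R} :=
  \poly_(d < n.+1) curve_row a 1 psi d (n - d).

Lemma horner_slice_poly (R : realType) (a : nat -> nat -> R) (psi : nat -> R) (n : nat) (s : R) :
  (slice_poly a psi n).[s] = curve_coef a s (fun m => s * psi m) n.
Proof.
rewrite horner_poly; apply: eq_bigr => d _.
by rewrite curve_rowZ mulrC.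
Qed.

(** The terms of a convergent series are bounded; the exponent n.+1 makes room for
    that bound when n = 0. *)
Lemma psum_coef_exp (R : realType) (c : nat -> R) (t x : R) :
  t != 0 -> psum_to c t x -> exists C, forall n, `|c n| <= C ^+ n.+1.
Proof.
move=> t0 /psum_terms_bounded[A HA].
have tp : 0 < `|t| by rewrite normr_gt0.
have A0 : 0 <= A by apply: le_trans (HA 0%N); rewrite mulr_ge0 ?exprn_ge0.
exists ((A + 1) * (1 + `|t|^-1)) => n.
have iv0 : 0 <= `|t|^-1 by rewrite invr_ge0.
have h : `|c n| <= A * `|t|^-1 ^+ n.
  by rewrite exprVn ler_pdivlMr ?exprn_gt0.
apply: (le_trans h); rewrite exprMn; apply: ler_pM => //.
  apply: (@le_trans _ _ (A + 1)); first by lra.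
  by rewrite exprS ler_peMr ?exprn_ege1//; lra.
apply: (@le_trans _ _ ((1 + `|t|^-1) ^+ n)); first by rewrite lerXn2r ?nnegrE//; lra.
by rewrite ler_weXn2l//; lra.
Qed.

(** The homogeneous part of degree d on the line x = 1, a polynomial in the slope y. *)
Definition homog_poly (R : realType) (a : nat -> nat -> R) (d : nat) : {poly R} :=
  \poly_(k < d.+1) a (d - k)%N k.

Lemma horner_homog_poly (R : realType) (a : nat -> nat -> R) (d : nat) (y : R) :
  (homog_poly a d).[y] = \sum_(i < d.+1) a i (d - i)%N * y ^+ (d - i).
Proof.
rewrite horner_poly (reindex_inj rev_ord_inj)/=; apply: eq_bigr => i _.
by rewrite subSS (subKn (leq_ord i)).
Qed.

Lemma psum_curve_row (R : realType) (a : nat -> nat -> R) (psi : nat -> R) (r D t y : R) (d : nat) :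
  `|t| <= r -> abs_bound psi r D -> psum_to psi t y ->
  psum_to (curve_row a 1 psi d) t (homog_poly a d).[y].
Proof.
move=> tr psiD psiy; rewrite horner_homog_poly.
rewrite /psum_to (_ : (fun i => _) = fun m => \sum_(i < d.+1)
     a i (d - i)%N * (cauchy_exp psi (d - i) m * t ^+ m)).
  apply: (@sums_to_sum _ (fun i m => a i (d - i)%N * (cauchy_exp psi (d - i) m * t ^+ m))
      (fun i => a i (d - i)%N * y ^+ (d - i))) => i.
  by apply: sums_toZ; exact: psumX tr psiD psiy.
apply/funext => m; rewrite /curve_row mulr_suml; apply: eq_bigr => i _.
by rewrite expr1n mulr1 mulrA.
Qed.

(** * Polynomials bounded on an interval *)

Lemma coef_prod_XsubC_le (K : numDomainType) (I : Type) (s : seq I) (P : pred I)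
    (x : I -> K) (k : nat) :
  `|(\prod_(j <- s | P j) ('X - (x j)%:P))`_k| <= \prod_(j <- s | P j) (1 + `|x j|).
Proof.
move: k; elim/big_rec2: _ => [|j y p _ IH] k.
  by rewrite coef1; case: eqP => _; rewrite ?normr1 ?normr0 ?ler01.
have y0 : 0 <= y by exact: le_trans (IH 0%N).
rewrite mulrDl coefD -polyCN coefCM coefXM mulrDl mul1r.
apply: le_trans (ler_normD _ _) _; apply: lerD.
  by case: eqP => _; rewrite ?normr0.
by rewrite normrM normrN ler_wpM2l.
Qed.

(** The product of the |i - j| for j < n distinct from i: up to scaling, the denominator
    of the Lagrange basis polynomial at equally spaced nodes. *)
Definition gap_prod (n i : nat) : nat :=
  \prod_(j < n) (if (j : nat) == i then 1 else (i - j) + (j - i)).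

Lemma gap_prodE (d i : nat) : (i <= d)%N -> gap_prod d.+1 i = (i`! * (d - i)`!)%N.
Proof.
elim: d => [|d IH].
  by rewrite leqn0 => /eqP ->; rewrite /gap_prod big_ord_recl big_ord0.
rewrite leq_eqVlt => /orP[/eqP ->|id].
  rewrite /gap_prod big_ord_recr/= eqxx muln1 subnn fact0 muln1.
  rewrite (eq_bigr (fun j : 'I_d.+1 => (d.+1 - j)%N)); last first.
    move=> j _; have jd := ltn_ord j.
    have -> : ((j : nat) == d.+1) = false by lia.
    by rewrite (_ : (j - d.+1 = 0)%N) ?addn0//; lia.
  elim: (d.+1) => [|n IHn]; first by rewrite big_ord0.
  by rewrite big_ord_recl/= subn0 factS -IHn.
rewrite /gap_prod big_ord_recr/= -/(gap_prod d.+1 i) IH; last by lia.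
have -> : d.+1 == i = false by lia.
have -> : (i - d.+1 + (d.+1 - i) = d.+1 - i)%N by lia.
have -> : (d.+1 - i = (d - i).+1)%N by lia.
by rewrite factS; lia.
Qed.

(** The quotient d! / (i! (d - i)!) is a binomial coefficient, hence at most 2^d. *)
Lemma fact_le_gap_prod (d i : nat) : (i <= d)%N -> (d`! <= 2 ^ d * gap_prod d.+1 i)%N.
Proof.
move=> id; rewrite gap_prodE// -(bin_fact id) leq_mul2r; apply/orP; right.
rewrite -[2%N]/(1 + 1)%N expnDn.
have hi : (i < d.+1)%N by [].
by rewrite (bigD1 (Ordinal hi))//= !exp1n !muln1 leq_addr.
Qed.

Lemma expn_le_expR_fact (R : realType) (d : nat) :
  d.+1%:R ^+ d <= expR 1 ^+ d.+1 * d`!%:R :> R.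
Proof.
rewrite -ler_pdivrMr ?ltr0n ?fact_gt0//.
rewrite -expRM_natl mulr1; case: d => [|d].
  by rewrite expr0 fact0 divr1; apply: le_trans (expR_ge1Dx _); lra.
by have := @expR_ge1Dxn R d.+2%:R d (ler0n _ _); lra.
Qed.

(** Lagrange interpolation at d + 1 equally spaced nodes of an interval of length L. The
    denominators are at least (L / (d + 1))^d d! / 2^d, and (d + 1)^d <= e^(d+1) d!, so the
    interpolation loses a factor that is only exponential in d. *)
Lemma interval_coef_bound (R : realType) (al be : R) : al < be ->
  exists2 C : R, 1 <= C & forall (q : {poly R}) (d : nat) (A : R),
    (size q <= d.+1)%N -> (forall x, al <= x <= be -> `|q.[x]| <= A) ->
    forall k, `|q`_k| <= A * C ^+ d.+1.
Proof.
move=> albe; pose L := be - al; have L0 : 0 < L by rewrite subr_gt0.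
pose X0 := 1 + `|al| + `|be|.
have X01 : 1 <= X0 by rewrite /X0 -addrA lerDl addr_ge0.
pose c := Num.max 1 (X0 * 2 / L).
have c1 : 1 <= c by rewrite le_max lexx.
have e1 : 1 <= expR 1 :> R by apply: le_trans (expR_ge1Dx _); lra.
exists (2 * expR 1 * c); first by rewrite !mulr_ege1// ler1n.
move=> q d A sq qA k.
have A0 : 0 <= A by apply: le_trans (qA al _); rewrite // lexx ltW.
(* The step L / (d + 1), rather than L / d, keeps the nodes inside for d = 0 too. *)
pose x (i : nat) := al + i%:R * (L / d.+1%:R).
have d0 : 0 < d.+1%:R :> R by rewrite ltr0n.
have h0 : 0 < L / d.+1%:R by rewrite divr_gt0.
have xin (i : 'I_d.+1) : al <= x i <= be.
  rewrite /x lerDl mulr_ge0 ?(ltW h0)//= -lerBrDl -/L mulrCA ger_pMr//.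
  by rewrite ler_pdivrMr// mul1r ler_nat ltnW.
have xX (i : 'I_d.+1) : 1 + `|x i| <= X0.
  have /andP[xa xb] := xin i; rewrite /X0 -addrA lerD2l ler_norml.
  have := ler_norm (- al); have := ler_norm be; rewrite normrN.
  have := normr_ge0 al; have := normr_ge0 be; lra.
have xxE (i j : 'I_d.+1) : `|x i - x j| = ((i - j) + (j - i))%:R * (L / d.+1%:R).
  rewrite /x opprD addrACA subrr add0r -mulrBl normrM (gtr0_norm h0); congr (_ * _).
  have [ij|/ltnW ij] := leqP i j.
    have -> : (i - j = 0)%N by lia.
    by rewrite distrC -natrB// ger0_norm.
  have -> : (j - i = 0)%N by lia.
  by rewrite -natrB// ger0_norm ?addn0.
have xx0 (i j : 'I_d.+1) : j != i -> x i - x j != 0.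
  move=> ji; rewrite -normr_gt0 xxE mulr_gt0// ltr0n.
  by have : (j : nat) != i by []; lia.
pose ell (i : 'I_d.+1) := \prod_(j < d.+1 | j != i) ('X - (x j)%:P).
pose w (i : 'I_d.+1) := \prod_(j < d.+1 | j != i) (x i - x j).
have w0 i : w i != 0 by apply/prodf_neq0 => j ji; exact: xx0.
have ellE (i j : 'I_d.+1) : (ell i).[x j] = if j == i then w i else 0.
  rewrite /ell horner_prod; case: eqP => [->|/eqP ji].
    by apply: eq_bigr => l _; rewrite hornerXsubC.
  by rewrite (bigD1 j)//= hornerXsubC subrr mul0r.
have qE : q = \sum_(i < d.+1) (q.[x i] / w i) *: ell i.
  apply/eqP; rewrite -subr_eq0; apply/eqP.
  apply: (@roots_geq_poly_eq0 _ _ [seq x (i : 'I_d.+1) | i <- enum 'I_d.+1]).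
  - apply/allP => _ /mapP[i _ ->]; rewrite rootE hornerD hornerN horner_sum.
    rewrite (bigD1 i)//= hornerZ ellE eqxx divfK// big1 ?addr0 ?subrr// => j ji.
    by rewrite hornerZ ellE eq_sym (negbTE ji) mulr0.
  - rewrite map_inj_uniq ?enum_uniq// => i j xij; apply/eqP/negPn/negP => ij.
    by have := xx0 j i ij; rewrite xij subrr eqxx.
  - rewrite size_map size_enum_ord; apply: leq_trans (size_polyD _ _) _.
    rewrite geq_max sq size_polyN/=; apply: leq_trans (size_sum _ _ _) _.
    apply/bigmax_leqP => i _; apply: leq_trans (size_scale_leq _ _) _.
    rewrite /ell -big_filter size_prod_XsubC ltnS size_filter -sum1_count.
    by rewrite sum1_card cardC1 card_ord.
have ellk (i : 'I_d.+1) : `|(ell i)`_k| <= X0 ^+ d.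
  apply: le_trans (coef_prod_XsubC_le _ _ _ _) _.
  apply: (@le_trans _ _ (\prod_(j < d.+1 | j != i) X0)).
    by apply: ler_prod => j _; rewrite xX andbT addr_ge0.
  by rewrite prodr_const cardC1 card_ord.
have wE (i : 'I_d.+1) : `|w i| = (gap_prod d.+1 i)%:R * (L / d.+1%:R) ^+ d.
  rewrite /w normr_prod (eq_bigr _ (fun j _ => xxE i j)) big_split/=.
  rewrite prodr_const cardC1 card_ord; congr (_ * _).
  rewrite /gap_prod natr_prod [RHS](bigD1 i)//= eqxx mul1r.
  by apply: eq_bigr => j ji; rewrite -val_eqE/= in ji; rewrite (negbTE ji).
have Lw (i : 'I_d.+1) : L ^+ d <= `|w i| * (2 ^+ d * expR 1 ^+ d.+1).
  rewrite wE expr_div_n.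
  have : d.+1%:R ^+ d <= expR 1 ^+ d.+1 * (2 ^+ d * (gap_prod d.+1 i)%:R) :> R.
    apply: le_trans (expn_le_expR_fact R d) _.
    rewrite ler_wpM2l ?exprn_ge0 ?expR_ge0// -natrX -natrM ler_nat.
    by apply: fact_le_gap_prod; rewrite -ltnS.
  have dd : 0 < d.+1%:R ^+ d :> R by rewrite exprn_gt0.
  rewrite -(ler_pM2l (exprn_gt0 d L0)) => h.
  rewrite -[leLHS](mulfK (lt0r_neq0 dd)) ler_pdivrMr//; apply: le_trans h _.
  rewrite le_eqVlt; apply/orP; left; apply/eqP; field.
  by rewrite lt0r_neq0.
have ti (i : 'I_d.+1) : `|(q.[x i] / w i) * (ell i)`_k| <=
    A * ((2 * X0 / L) ^+ d * expR 1 ^+ d.+1).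
  have qi : `|q.[x i]| <= A by apply: qA; exact: xin.
  rewrite normrM normf_div -[leLHS]mulrA; apply: ler_pM => //.
  have wp : 0 < `|w i| by rewrite normr_gt0.
  rewrite mulrC ler_pdivrMr//; apply: le_trans (ellk i) _.
  have Ld : 0 < L ^+ d by rewrite exprn_gt0.
  rewrite -(ler_pM2l Ld).
  apply: le_trans (ler_wpM2r _ (Lw i)) _; first by rewrite exprn_ge0// (le_trans ler01).
  rewrite le_eqVlt; apply/orP; left; apply/eqP.
  by rewrite !exprMn exprVn; field; rewrite lt0r_neq0.
rewrite {1}qE coef_sum; apply: le_trans (ler_norm_sum _ _ _) _.
apply: (@le_trans _ _ (\sum_(i < d.+1) A * ((2 * X0 / L) ^+ d * expR 1 ^+ d.+1))).
  by apply: ler_sum => i _; rewrite coefZ.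
rewrite sumr_const card_ord -[leLHS]mulr_natl mulrCA ler_wpM2l//.
rewrite [(2 * expR 1 * c) ^+ _]exprMn [(2 * expR 1) ^+ _]exprMn [leLHS]mulrA [leRHS]mulrAC ler_wpM2r ?exprn_ge0 ?expR_ge0//.
have X0L : 0 <= 2 * X0 / L by rewrite divr_ge0 ?(ltW L0)// mulr_ge0// (le_trans ler01).
apply: ler_pM; rewrite ?exprn_ge0//; first by rewrite -natrX ler_nat ltnW// ltn_expl.
have c0 : 0 <= c by exact: le_trans c1.
have hc : 2 * X0 / L <= c by rewrite /c [2 * X0]mulrC le_max lexx orbT.
apply: (@le_trans _ _ (c ^+ d)); first by rewrite lerXn2r ?nnegrE.
by rewrite ler_weXn2l.
Qed.

(** * Polynomials bounded on a set of positive capacity *)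

Definition Borelc (R : realType) := g_sigma_algebraType (@open (Cplx R)).

Lemma normc_normr (R : realType) (z : R[i]) : `|z : Cplx R| = (normc z)%:C.
Proof. by []. Qed.

Lemma open_measurablec (R : realType) (A : set (Cplx R)) :
  open A -> measurable (A : set (Borelc R)).
Proof. by move=> oA; apply: sub_sigma_algebra. Qed.

Lemma closed_measurablec (R : realType) (A : set (Cplx R)) :
  closed A -> measurable (A : set (Borelc R)).
Proof.
move=> cA; rewrite -(setCK A); apply: measurableC; apply: open_measurablec.
exact: closed_openC.
Qed.

Lemma open_normc_gt (R : realType) (z : R[i]) (a : R) :
  open ([set w | a < normc (z - w)] : set (Cplx R)).
Proof.
rewrite openE => w0 /= aw; apply/nbhs_ballP.
exists ((normc (z - w0) - a)%:C); first by rewrite /= ltcR subr_gt0.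
move=> w; rewrite /ball /= normc_normr ltcR => ww.
have := @le_normcD R (z - w) (w - w0); rewrite subrKA => h.
have e : normc (w0 - w) = normc (w - w0) by rewrite -opprB normcN.
rewrite /= in ww *; lra.
Qed.

Lemma closed_normc_le (R : realType) (z : R[i]) (a : R) :
  closed ([set w | normc (z - w) <= a] : set (Cplx R)).
Proof.
rewrite -openC; have -> : ~` [set w | normc (z - w) <= a] = 
    [set w | a < normc (z - w)].
  by apply/seteqP; split => w /=; rewrite ltNge => /negP.
exact: open_normc_gt.
Qed.

Lemma measurable_normc (R : realType) (z : R[i]) (D : set (Borelc R)) :
  measurable_fun D (fun w : Borelc R => normc (z - (w : R[i]))).
Proof.
move=> mD; apply: (measurability _ (RGenOInfty.measurableE R)) => //.
move=> _ [_ [x ->] <-]; apply: measurableI => //.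
have -> : (fun w : Borelc R => normc (z - (w : R[i]))) @^-1` `]x, +oo[ =
    [set w | x < normc (z - w)].
  by apply/seteqP; split=> w /=; rewrite in_itv /= andbT.
by apply: open_measurablec; exact: open_normc_gt.
Qed.

(** The kernel log (1 / |z - w|) truncated at N, in a form that needs no separate case
    at w = z. *)
Definition trunc_log (R : realType) (N : nat) (z w : R[i]) : R :=
  - ln (Num.max (expR (- N%:R)) (normc (z - w))).

Lemma trunc_logE (R : realType) (N : nat) (z w : R[i]) :
  Order.min (N%:R%:E) (log_kernel z w) = (trunc_log N z w)%:E.
Proof.
rewrite /log_kernel /trunc_log; set r := normc (z - w).
have r0 : 0 <= r by rewrite /r; case: (z - w) => a b; exact: sqrtr_ge0.
have e0 := expR_gt0 (- N%:R : R).
have [->|rn0] := eqVneq r 0.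
  by rewrite inver eqxx minEle leey maxEle leNgt e0 /= expRK opprK.
have rp : 0 < r by rewrite lt_neqAle eq_sym rn0.
rewrite inver (negbTE rn0) lne_EFin ?invr_gt0// lnV ?posrE//.
rewrite -EFin_min; congr EFin; rewrite minEle maxEle.
have -> : r = expR (ln r) by rewrite lnK ?posrE.
rewrite ler_expR expRK; move: (ln r) => l.
by case: leP => h; case: leP => h'; rewrite ?expRK ?opprK; lra.
Qed.

Lemma measurable_trunc_log (R : realType) (N : nat) (z : R[i])
    (D : set (Borelc R)) :
  measurable_fun D (fun w : Borelc R => trunc_log N z w).
Proof.
apply: measurable_funN; apply: (measurableT_comp (@measurable_ln R)).
apply: measurable_maxr; [exact: measurable_cst|exact: measurable_normc].
Qed.

Lemma trunc_log_le (R : realType) (N : nat) (z w : R[i]) :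
  trunc_log N z w <= N%:R.
Proof.
by rewrite /trunc_log lerNl -ler_expR lnK ?posrE ?lt_max ?expR_gt0// le_max lexx.
Qed.

Lemma trunc_log_ge (R : realType) (N : nat) (z w : R[i]) (r : R) :
  1 <= r -> normc (z - w) <= r -> - ln r <= trunc_log N z w.
Proof.
move=> r1 zw; have r0 : 0 < r by exact: lt_le_trans r1.
rewrite /trunc_log lerN2 ler_ln ?posrE ?lt_max ?expR_gt0//.
by rewrite ge_max zw andbT (le_trans _ r1)// -expR0 ler_expR oppr_le0.
Qed.

Lemma trunc_log_homo (R : realType) (M N : nat) (z w : R[i]) :
  (M <= N)%N -> trunc_log M z w <= trunc_log N z w.
Proof.
move=> MN; rewrite /trunc_log lerN2 ler_ln ?posrE ?lt_max ?expR_gt0//.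
by rewrite ge_max !le_max ler_expR lerN2 ler_nat MN lexx orbT.
Qed.

Lemma integrable_trunc_log (R : realType) (mu : probability (Borelc R) R)
    (K : set (Borelc R)) (n0 N : nat) (z : R[i]) :
  measurable K -> (forall w, K w -> normc (w : R[i]) <= n0%:R) ->
  mu.-integrable K (EFin \o (fun w : Borelc R => trunc_log N z w)).
Proof.
move=> mK Kb; apply: measurable_bounded_integrable => //.
- by rewrite (le_lt_trans (probability_le1 mu mK)) ?ltry.
- exact: measurable_trunc_log.
exists (N%:R + ln (1 + normc z + n0%:R))%R; split; first exact: num_real.
move=> M hM w /= Kw; apply/ltW/(le_lt_trans _ hM).
have z0 : 0 <= normc z by case: (z) => a b; exact: sqrtr_ge0.
have n00 : 0 <= n0%:R :> R by [].
have r1 : 1 <= 1 + normc z + n0%:R by lra.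
have h1 := trunc_log_le N z w.
have h2 : - ln (1 + normc z + n0%:R) <= trunc_log N z w.
  apply: trunc_log_ge => //; have := le_normcD z (- w); rewrite normcN.
  have := Kb _ Kw; lra.
have h3 : 0 <= ln (1 + normc z + n0%:R) by rewrite ln_ge0.
have h4 : 0 <= N%:R :> R by [].
rewrite ler_norml; apply/andP; split; lra.
Qed.

Lemma integral_carrier (R : realType) (mu : probability (Borelc R) R)
    (K : set (Borelc R)) (f : Borelc R -> \bar R) :
  measurable K -> mu K = 1%E -> measurable_fun setT f ->
  (\int[mu]_w f w = \int[mu]_(w in K) f w)%E.
Proof.
move=> mK K1 mf; rewrite [RHS]integral_mkcond; apply: ae_eq_integral => //.
  by apply/(measurable_restrictT f mK); exact: measurable_funTS.
exists (~` K); split; first exact: measurableC.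
  by have /= := probability_setC mu mK; rewrite K1 subee // => ->.
by move=> w /= h Kw; apply: h => _; rewrite patchE mem_set.
Qed.

Lemma potential_bound (R : realType) (mu : probability (Borelc R) R)
    (K : set (Borelc R)) (n0 N : nat) (M : \bar R) (z : R[i]) :
  measurable K -> (forall w, K w -> normc (w : R[i]) <= n0%:R) ->
  mu K = 1%E -> (potential mu z <= M)%E ->
  (\int[mu]_(w in K) (trunc_log N z w)%:E <= M)%E.
Proof.
move=> mK Kb K1; apply: le_trans; rewrite /potential.
have -> : (fun N : nat => \int[mu]_w Order.min (N%:R)%:E (log_kernel z (w : R[i])))%E
    = (fun N => \int[mu]_(w in K) (trunc_log N z w)%:E)%E.
  apply/funext => k; rewrite -(integral_carrier mK K1).
    by apply: eq_integral => w _; rewrite trunc_logE.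
  by apply/measurable_EFinP; exact: measurable_trunc_log.
set a := fun N : nat => _.
have nda : nondecreasing_seq a.
  move=> i j ij; apply: le_integral => //; try exact: (integrable_trunc_log _ _ _ mK Kb).
  by move=> w Kw; rewrite lee_fin trunc_log_homo.
rewrite (cvg_lim _ (ereal_nondecreasing_cvgn nda)) //.
by apply: ereal_sup_ubound; exists N.
Qed.

(** A finite infimum provides a measure with bounded potential. The truncated integrals
    increase to the potential, hence share its bound; the measure lives on the bounded set K,
    where the truncated kernel is bounded. *)
Lemma pos_cap_energy (R : realType) (E : set R[i]) :
  closed (E : set (Cplx R)) -> (0 < cap E)%E ->
  exists (n0 : nat) (mu : probability (Borelc R) R) (M : R) (K : set (Borelc R)),
   [/\ K = E `&` [set z | normc z <= n0%:R], measurable K, mu K = 1%E &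
     forall z N, (\int[mu]_(w in K) (trunc_log N z w)%:E <= M%:E)%E].
Proof.
move=> cE; rewrite /cap => cap0.
have [n cn] : exists n, (0 < cap_compact (E `&` [set z | (normc z <= n%:R)%R]))%E.
  apply: contrapT => /forallNP h; move: cap0; apply/negP; rewrite -leNgt.
  rewrite (_ : (fun n : nat => _) = cst 0%E) ?lim_cst//.
  apply/funext => n /=; apply/eqP; rewrite eq_le expeR_ge0 andbT leNgt.
  exact/negP/h.
exists n; set K : set (Borelc R) := E `&` _.
have mK : measurable K.
  apply: measurableI; first exact: closed_measurablec.
  have -> : [set z | normc z <= n%:R] = [set w : R[i] | normc (0 - w) <= n%:R].
    by apply/seteqP; split => w /=; rewrite sub0r normcN.
  by apply: closed_measurablec; exact: closed_normc_le.
move: cn; rewrite /cap_compact -/K; set S := [set _ | _ in _] => cn.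
have : (ereal_inf S < +oo)%E.
  by rewrite ltey; apply/eqP => h; move: cn; rewrite h /= ltxx.
move=> /ereal_inf_lt [_ [mu muK <-]] supfin.
have [M HM] : exists M : R, (ereal_sup (range (potential mu)) <= M%:E)%E.
  move: supfin; case: (ereal_sup _) => [r _|//|_]; first by exists r.
  by exists 0; exact: leNye.
exists mu, M, K; split => // z N.
apply: (potential_bound (n0 := n)) => //; first by move=> w [].
by apply: le_trans HM; apply: ereal_sup_ubound; exists z.
Qed.

(** The shift makes the kernel nonnegative for w in the disc of radius n0, so that
    integrals over a part of K are at most those over K. Its dependence on z matches the
    size of log |z - w| for large z. *)
Definition shifted_log (R : realType) (n0 N : nat) (z w : R[i]) : R :=
  ln ((1 + n0%:R) * Num.max 1 (normc z)) + trunc_log N z w.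

Lemma normc_ge0 (R : realType) (z : R[i]) : 0 <= normc z.
Proof. by case: z => a b; exact: sqrtr_ge0. Qed.

Lemma one_le_scale (R : realType) (n0 : nat) (z : R[i]) :
  1 <= (1 + n0%:R) * Num.max 1 (normc z).
Proof.
by rewrite mulr_ege1// ?lerDl// le_max lexx.
Qed.

Lemma shifted_log_ge0 (R : realType) (n0 N : nat) (z w : R[i]) :
  normc w <= n0%:R -> 0 <= shifted_log n0 N z w.
Proof.
move=> wn; rewrite /shifted_log addrC -lerBlDr sub0r.
apply: trunc_log_ge; first exact: one_le_scale.
have := le_normcD z (- w); rewrite normcN => h; apply: (le_trans h).
have z0 := normc_ge0 z; have n00 : 0 <= n0%:R :> R by [].
have m1 : 1 <= Num.max 1 (normc z) by rewrite le_max lexx.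
have m2 : normc z <= Num.max 1 (normc z) by rewrite le_max lexx orbT.
nra.
Qed.

Lemma shifted_log_far (R : realType) (n0 N : nat) (z w : R[i]) :
  normc w <= n0%:R -> 1 + n0%:R *+ 2 <= normc z ->
  shifted_log n0 N z w <= ln (2 * (1 + n0%:R)).
Proof.
move=> wn zn; have n00 : 0 <= n0%:R :> R by [].
have z1 : 1 <= normc z by lra.
rewrite /shifted_log; have -> : Num.max 1 (normc z) = normc z by apply/max_idPr.
have h : normc z / 2 <= normc (z - w).
  have := le_normcD (z - w) w; rewrite subrK; lra.
have zp : 0 < normc z by lra.
have -> : ln (2 * (1 + n0%:R)) = ln ((1 + n0%:R) * normc z) - ln (normc z / 2) :> R.
  rewrite -ln_div ?posrE ?mulr_gt0 ?divr_gt0 ?ltr_pwDl//; congr ln.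
  by field; rewrite gt_eqF.
rewrite lerD2l /trunc_log lerN2 ler_ln ?posrE ?lt_max ?expR_gt0 ?divr_gt0//.
by rewrite le_max h orbT.
Qed.

Lemma integral_constc (R : realType) (mu : probability (Borelc R) R)
    (K : set (Borelc R)) (r : R) : measurable K ->
  (\int[mu]_(w in K) r%:E = r%:E * mu K)%E.
Proof. by move=> mK; rewrite -integral_cst. Qed.

(** Far away the shift compensates the kernel pointwise; for z in a bounded region the
    shift is bounded and the potential takes care of the kernel. *)
Lemma shifted_log_integral (R : realType) (mu : probability (Borelc R) R)
    (n0 : nat) (M : R) (K : set (Borelc R)) (N : nat) (z : R[i]) :
  measurable K -> (forall w, K w -> normc (w : R[i]) <= n0%:R) ->
  mu K = 1%E -> (\int[mu]_(w in K) (trunc_log N z w)%:E <= M%:E)%E ->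
  (\int[mu]_(w in K) (shifted_log n0 N z w)%:E <=
   (Num.max 0 M + ln ((1 + n0%:R) * (1 + n0%:R *+ 2)) + ln (2 * (1 + n0%:R)))%:E)%E.
Proof.
have n00 : 0 <= n0%:R :> R by [].
have p1 : 0 < (1 + n0%:R) * (1 + n0%:R *+ 2) :> R by rewrite mulr_gt0//; lra.
have p2 : 0 <= ln ((1 + n0%:R) * (1 + n0%:R *+ 2) : R).
  by rewrite ln_ge0// mulr_ege1//; lra.
have p3 : 0 <= ln (2 * (1 + n0%:R) : R) by rewrite ln_ge0//; lra.
have M0 : 0 <= Num.max 0 M by rewrite le_max lexx.
have MM : M <= Num.max 0 M by rewrite le_max lexx orbT.
have n1 : 0 < 1 + n0%:R :> R by lra.
have [zn|/ltW zn] := leP (1 + n0%:R *+ 2) (normc z).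
  have q : ln (2 * (1 + n0%:R)) <= Num.max 0 M +
    ln ((1 + n0%:R) * (1 + n0%:R *+ 2)) + ln (2 * (1 + n0%:R)) by lra.
  move=> mK Kb K1 HM.
  apply: (@le_trans _ _ (\int[mu]_(w in K) (ln (2 * (1 + n0%:R)))%:E)%E).
    apply: ge0_le_integral => //.
    - by move=> w Kw; rewrite lee_fin shifted_log_ge0// Kb.
    - apply/measurable_EFinP; apply: measurable_funD; first exact: measurable_cst.
      exact: measurable_trunc_log.
    - by move=> w Kw; rewrite lee_fin shifted_log_far// Kb.
  by rewrite integral_constc // K1 mule1 lee_fin.
have q : ln ((1 + n0%:R) * Num.max 1 (normc z)) + M <= Num.max 0 M +
    ln ((1 + n0%:R) * (1 + n0%:R *+ 2)) + ln (2 * (1 + n0%:R)).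
  suff : ln ((1 + n0%:R) * Num.max 1 (normc z)) <=
         ln ((1 + n0%:R) * (1 + n0%:R *+ 2)) by lra.
  rewrite ler_ln ?posrE//; last exact: lt_le_trans (one_le_scale n0 z).
  by rewrite ler_pM2l// ge_max zn andbT; lra.
move=> mK Kb K1 HM; apply: le_trans (_ : _ <= (_ + M)%:E)%E _; last first.
  by rewrite lee_fin; exact: q.
under eq_integral do rewrite /shifted_log EFinD.
rewrite integralD //; last exact: (integrable_trunc_log _ _ _ mK Kb).
  by rewrite integral_constc // K1 mule1 EFinD leeD2l.
apply: (measurable_bounded_integrable (f := fun=> _)) => //.
  by rewrite (le_lt_trans (probability_le1 mu mK)) ?ltry.
exact: bounded_cst.
Qed.

(** A value below N certifies that the truncation was not active, and in particular that
    w is not z. *)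
Lemma max1_le_shifted_log (R : realType) (n0 N : nat) (z w : R[i]) :
  shifted_log n0 N z w < N%:R ->
  Num.max 1 (normc z) <= expR (shifted_log n0 N z w) * normc (w - z).
Proof.
rewrite /shifted_log => h.
have h1 := one_le_scale n0 z.
have l0 : 0 <= ln ((1 + n0%:R) * Num.max 1 (normc z)) by rewrite ln_ge0.
have h2 : trunc_log N z w < N%:R by lra.
have h3 : Num.max (expR (- N%:R)) (normc (z - w)) = normc (z - w).
  apply/max_idPr; rewrite leNgt; apply/negP => /ltW /max_idPl e.
  by move: h2; rewrite /trunc_log e expRK opprK ltxx.
have h4 : 0 < normc (z - w) by rewrite -h3 lt_max expR_gt0.
rewrite expRD lnK ?posrE ?(lt_le_trans _ h1)// /trunc_log h3 expRN lnK ?posrE//.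
have -> : normc (w - z) = normc (z - w) by rewrite -opprB normcN.
rewrite divfK ?gt_eqF//; apply: ler_peMl; last by rewrite lerDl.
by rewrite le_max ler01.
Qed.

Lemma ltr_mulrS (R : realType) (x : R) (d : nat) :
  0 <= x -> x *+ d < (x + 1) *+ d.+1.
Proof.
move=> x0; rewrite mulrSr mulrnDl -addrA ltrDl; apply: ltr_wpDl => //.
by rewrite ltr_wpDl.
Qed.

(** The mean over K' of the sum of the shifted logarithms is at most a constant times the
    number of roots, by the uniform bound on K. At some w the sum is no larger than that,
    and exponentiating gives the product inequality. *)
Lemma far_from_roots (R : realType) (mu : probability (Borelc R) R)
    (n0 : nat) (M : R) (K K' : set (Borelc R)) :
  measurable K -> (forall w, K w -> normc (w : R[i]) <= n0%:R) ->
  mu K = 1%E ->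
  (forall z N, (\int[mu]_(w in K) (trunc_log N z w)%:E <= M%:E)%E) ->
  measurable K' -> K' `<=` K -> (0 < mu K')%E ->
  exists2 C : R, 0 < C & forall zs : seq R[i], exists2 w : R[i], K' w &
    \prod_(z <- zs) Num.max 1 (normc z) <=
      C ^+ (size zs).+1 * \prod_(z <- zs) normc (w - z).
Proof.
pose M1 := Num.max 0 M + ln ((1 + n0%:R) * (1 + n0%:R *+ 2)) + ln (2 * (1 + n0%:R)).
have n00 : 0 <= n0%:R :> R by [].
have M10 : 0 <= M1.
  have h : 1 <= 1 + n0%:R *+ 2 :> R by lra.
  have h1 : 1 <= 1 + n0%:R :> R by lra.
  by rewrite !addr_ge0 ?le_max ?lexx// ln_ge0 ?mulr_ege1// ler1n.
have M1S d : M1 *+ d < (M1 + 1) *+ d.+1 by exact: ltr_mulrS.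
have M11 : 0 <= M1 + 1 by lra.
move=> mK Kb K1 HM mK' K'K K'0.
pose c := fine (mu K').
have mK'fin : mu K' \is a fin_num by rewrite fin_num_measure.
have c0 : 0 < c by rewrite /c fine_gt0// K'0/= ltey_eq mK'fin.
exists (expR ((M1 + 1) / c)); first exact: expR_gt0.
move=> zs; pose S := (M1 + 1) / c *+ (size zs).+1.
have S0 : 0 <= S by rewrite mulrn_wge0// divr_ge0 ?(ltW c0).
(* Beyond S: a sum of nonnegative terms that is at most S has no truncated term. *)
pose N := (Num.truncn S).+1.
have SN : S < N%:R by rewrite /N truncnS_gt.
have sg0 z w : K' w -> 0 <= shifted_log n0 N z w.
  by move=> /K'K/Kb; exact: shifted_log_ge0.
have [w K'w wS] : exists2 w, K' w & \sum_(z <- zs) shifted_log n0 N z w <= S.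
  apply: contrapT => h.
  have {}h : forall w, K' w -> S <= \sum_(z <- zs) shifted_log n0 N z w.
    move=> w K'w; rewrite leNgt; apply/negP => ?; apply: h; exists w => //.
    exact: ltW.
  have : (S%:E * mu K' <= (M1 *+ size zs)%:E)%E.
    rewrite -integral_constc//.
    have ms z : measurable_fun K (fun w : Borelc R => (shifted_log n0 N z w)%:E).
      apply/measurable_EFinP; apply: measurable_funD; first exact: measurable_cst.
      exact: measurable_trunc_log.
    have ms' z : measurable_fun K' (fun w : Borelc R => (shifted_log n0 N z w)%:E).
      exact: measurable_funS (ms z).
    apply: (@le_trans _ _ (\int[mu]_(w in K') \sum_(z <- zs) (shifted_log n0 N z w)%:E)%E).
      apply: ge0_le_integral => //.
      - by apply: emeasurable_sum => z; exact: ms'.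
      - by move=> w K'w; rewrite sumEFin lee_fin h.
    have f0 z w : K' w -> (0 <= (shifted_log n0 N z w)%:E)%E.
      by move=> /sg0; rewrite lee_fin.
    rewrite ge0_integral_sum //.
    have -> : (M1 *+ size zs)%:E = (\sum_(z <- zs) M1%:E)%E.
      by rewrite sumEFin big_const_seq count_predT iter_addr_0.
    apply: lee_sum => z _.
    apply: le_trans (shifted_log_integral mK Kb K1 (HM z N)).
    apply: ge0_subset_integral => //.
    by move=> w /Kb; rewrite lee_fin; exact: shifted_log_ge0.
  rewrite -(fineK mK'fin) -EFinM lee_fin -/c /S mulrnAl divfK ?gt_eqF//.
  by rewrite leNgt M1S.
exists w => //; rewrite -expRM_natl.
have sN z : z \in zs -> shifted_log n0 N z w < N%:R.
  move=> zzs; apply: le_lt_trans SN; apply: le_trans wS.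
  rewrite (big_rem z zzs)/= lerDl; apply: sumr_ge0 => y _; exact: sg0.
have : \prod_(z <- zs) Num.max 1 (normc z) <=
       \prod_(z <- zs) (expR (shifted_log n0 N z w) * normc (w - z)).
  rewrite big_seq [leRHS]big_seq; apply: ler_prod => z zzs.
  by rewrite le_max ler01/=; exact/max1_le_shifted_log/sN.
move=> /le_trans; apply; rewrite big_split/= ler_wpM2r ?prodr_ge0//.
  by move=> z _; exact: normc_ge0.
by rewrite -expR_sum ler_expR (le_trans wS)// /S mulr_natl.
Qed.

Lemma continuous_horner (K : numFieldType) (p : {poly K}) :
  continuous (fun x : K => p.[x] : K).
Proof.
elim/poly_ind: p => [|p c IH].
  rewrite (_ : (fun x : K => _) = (fun=> (0 : K))); first exact: cst_continuous.
  by apply/funext => x; rewrite horner0.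
rewrite (_ : (fun x : K => _) = (fun x : K => (p.[x] : K) * x + (c : K))).
  have h : continuous (fun x : K => (p.[x] : K) * x).
    move=> w; apply: (@continuousM K K (fun x : K => (p.[x] : K)) id).
      exact: IH.
    by move=> ?.
  move=> w; apply: (@continuousD K K K (fun x : K => (p.[x] : K) * x) (fun=> c)).
    exact: h.
  exact: cst_continuous.
by apply/funext => x; rewrite hornerMXaddC.
Qed.

Lemma closed_horner_le (R : realType) (p : {poly R[i]}) (a : R) :
  closed ([set w | normc p.[w] <= a] : set (Cplx R)).
Proof.
have -> : [set w | normc p.[w] <= a] =
  ((fun w => p.[w]) : Cplx R -> Cplx R) @^-1` [set w | normc (0 - w) <= a].
  by apply/seteqP; split => w /=; rewrite sub0r normcN.
apply: closed_comp; last exact: closed_normc_le.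
by move=> w _; exact: (@continuous_horner (Cplx R)).
Qed.

Lemma normc_coef_prod_XsubC_le (R : realType) (zs : seq R[i]) (i : nat) :
  normc (\prod_(z <- zs) ('X - z%:P))`_i <= \prod_(z <- zs) (1 + normc z).
Proof.
have e : (\prod_(z <- zs) (1 + normc z))%:C = \prod_(z <- zs) (1 + `|z|) :> R[i].
  by rewrite rmorph_prod; apply: eq_bigr => z _; rewrite rmorphD rmorph1.
rewrite -lecR e.
exact: (coef_prod_XsubC_le zs xpredT id i).
Qed.

Lemma normc_prod (R : realType) (T : Type) (s : seq T) (f : T -> R[i]) :
  normc (\prod_(z <- s) f z) = \prod_(z <- s) normc (f z).
Proof.
by elim: s => [|z s IH]; rewrite ?big_nil ?normc1// !big_cons normcM IH.
Qed.

(** The coefficients of a prod_i (X - z_i) are at most |a| prod_i (1 + |z_i|), hence at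
    most 2^n |a| prod_i max(1, |z_i|), which the chosen point w compares with |p(w)|. *)
Lemma coef_le_of_roots (R : realType) (p : {poly R[i]}) (C : R) (n : nat)
    (A : set R[i]) (B : R) :
  (size p <= n.+1)%N -> 1 <= C ->
  (forall zs : seq R[i], exists2 w : R[i], A w &
    \prod_(z <- zs) Num.max 1 (normc z) <=
      C ^+ (size zs).+1 * \prod_(z <- zs) normc (w - z)) ->
  (forall w, A w -> normc p.[w] <= B) ->
  forall i, normc p`_i <= (2 * C) ^+ n.+1 * B.
Proof.
move=> sp C1 far pB i.
have B0 : 0 <= B.
  have [w0 Aw0 _] := far [::]; exact: le_trans (normc_ge0 _) (pB _ Aw0).
have CC : 1 <= 2 * C by lra.
have [->|p0] := eqVneq p 0.
  rewrite coef0 normc0 mulr_ge0// exprn_ge0//; exact: le_trans CC.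
have [zs pE] := closed_field_poly_normal p.
have [w Aw wzs] := far zs.
have szs : (size zs <= n)%N.
  have := congr1 (fun q : {poly _} => size q) pE.
  rewrite size_scale ?lead_coef_eq0// size_prod_XsubC => e.
  by rewrite -ltnS -e.
rewrite pE coefZ normcM.
have := pB _ Aw; rewrite {1}pE hornerZ normcM horner_prod normc_prod.
under eq_bigr do rewrite hornerXsubC.
set a := normc (lead_coef p) => aB.
have a0 : 0 <= a by exact: normc_ge0.
have h2 : \prod_(z <- zs) (1 + normc z) <=
    2 ^+ (size zs) * \prod_(z <- zs) Num.max 1 (normc z).
  elim: (zs) => [|z s IH]; first by rewrite !big_nil mulr1.
  rewrite !big_cons /= exprS mulrACA; apply: ler_pM => //.
  - by rewrite addr_ge0 ?normc_ge0.
  - by apply: prodr_ge0 => y _; rewrite addr_ge0 ?normc_ge0.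
  - by rewrite mulr_natl mulr2n lerD // le_max lexx ?orbT.
apply: (@le_trans _ _ (a * (2 ^+ (size zs) * (C ^+ (size zs).+1 * \prod_(z <- zs) normc (w - z))))).
  rewrite ler_wpM2l//; apply: le_trans (normc_coef_prod_XsubC_le zs i) _.
  by apply: le_trans h2 _; rewrite ler_wpM2l ?exprn_ge0.
rewrite mulrC -!mulrA mulrA [X in _ * X]mulrC.
apply: ler_pM => //.
- by rewrite mulr_ge0 ?exprn_ge0//; lra.
- by rewrite mulr_ge0// prodr_ge0// => z _; exact: normc_ge0.
apply: (@le_trans _ _ ((2 * C) ^+ (size zs).+1)); last first.
  by rewrite ler_weXn2l.
by rewrite exprMn ler_wpM2r ?exprn_ge0 ?ler_weXn2l //; lra.
Qed.

Lemma exists_pos_measure_piece (R : realType) (mu : probability (Borelc R) R)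
  (K : set (Borelc R)) (A : nat -> set (Borelc R)) :
  measurable K -> mu K = 1%E -> (forall m, measurable (A m)) -> K `<=` \bigcup_m A m ->
  exists m, (0 < mu (A m))%E.
Proof.
move=> mK K1 mA KA; apply: contrapT => /forallNP h.
have N m : mu.-negligible (A m).
  apply/negligibleP => //; apply/eqP; rewrite eq_le measure_ge0 andbT leNgt.
  exact/negP/h.
have : mu.-negligible K by exact: negligibleS KA (negligible_bigcup N).
move=> [B [mB B0 KB]].
have : (mu K <= mu B)%E by apply: le_measure; rewrite ?inE.
by rewrite K1 B0 lee_fin ler10.
Qed.

Lemma normc_real (R : realType) (x : R) : normc (x%:C) = `|x|.
Proof. by rewrite /= expr0n addr0 sqrtr_sqr. Qed.

(** The compact part K of E carrying the measure is the union over m of the closed sets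
    where |P_n| <= m^(n+1) for all n; one of these has positive mass. *)
Lemma pos_cap_coef_bound (R : realType) (E : set R) (P : nat -> {poly R}) :
  closed ([set s%:C | s in E] : set (Cplx R)) ->
  (0 < cap [set s%:C | s in E])%E ->
  (forall n, (size (P n) <= n.+1)%N) ->
  (forall s, E s -> exists C, forall n, `|(P n).[s]| <= C ^+ n.+1) ->
  exists2 C : R, 1 <= C & forall n i, `|(P n)`_i| <= C ^+ n.+1.
Proof.
move=> cE capE sP PE.
have [n0 [mu [M [K [KE mK K1 HM]]]]] := pos_cap_energy cE capE.
pose Q n := map_poly (real_complex R) (P n).
pose A (m : nat) : set (Borelc R) :=
  K `&` \bigcap_n [set w | normc (Q n).[w] <= m%:R ^+ n.+1].
have mA m : measurable (A m).
  apply: measurableI => //; apply: bigcap_measurable; first by exists 0%N.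
  by move=> n _; apply: closed_measurablec; exact: closed_horner_le.
have KA : K `<=` \bigcup_m A m.
  move=> w Kw; move: (Kw); rewrite KE => -[[s Es sw] _].
  have [C HC] := PE s Es; exists (Num.truncn `|C|).+1 => //; split => // n _ /=.
  rewrite -sw horner_map normc_real; apply: le_trans (HC n) _.
  apply: le_trans (ler_norm _) _; rewrite normrX lerXn2r ?nnegrE//.
  by rewrite ltW// truncnS_gt.
have [m Am] := exists_pos_measure_piece mK K1 mA KA.
have Kb w : K w -> normc (w : R[i]) <= n0%:R by rewrite KE => -[].
have AK : A m `<=` K by move=> w [].
have [C C0 HC] := far_from_roots mK Kb K1 HM (mA m) AK Am.
pose C1 := Num.max 1 C.
have C11 : 1 <= C1 by rewrite le_max lexx.
have CC1 : C <= C1 by rewrite le_max lexx orbT.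
have far (zs : seq R[i]) : exists2 w, A m w & \prod_(z <- zs) Num.max 1 (normc z) <=
      C1 ^+ (size zs).+1 * \prod_(z <- zs) normc (w - z).
  have [w Aw hw] := HC zs; exists w => //; apply: le_trans hw _.
  rewrite ler_wpM2r ?prodr_ge0//; first by move=> z _; exact: normc_ge0.
  by rewrite lerXn2r ?nnegrE ?(ltW C0)// (le_trans ler01).
exists (Num.max 1 (2 * C1 * m%:R)); first by rewrite le_max lexx.
move=> n i; have sQ : (size (Q n) <= n.+1)%N by rewrite size_map_poly.
have QB w : A m w -> normc (Q n).[w] <= m%:R ^+ n.+1 by case=> _; apply.
have := coef_le_of_roots sQ C11 far QB i.
rewrite coef_map normc_real -exprMn => /le_trans; apply.
have h : 0 <= 2 * C1 * m%:R by rewrite !mulr_ge0// (le_trans ler01).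
by rewrite lerXn2r ?nnegrE// le_max ?h ?lexx ?orbT.
Qed.

(** * Convergence of the Taylor series and conclusion *)

Lemma analytic_sub_linear (R : realType) (I : set R) (phi : R -> R) (c : R) :
  analytic_on_itv I phi -> analytic_on_itv I (fun t => phi t - c * t).
Proof.
move=> an t0 It0; have [a [r [r0 ha]]] := an t0 It0.
(* The expansion c t0 + c (t - t0) of the linear function at t0. *)
pose l n := if n is n'.+1 then (if n' is 0%N then c else 0) else c * t0.
exists (fun n => a n - l n), r; split=> // t It tr.
apply/psum_to_pseries; apply: psum_toB; first by apply/psum_to_pseries; exact: ha.
rewrite /psum_to /sums_to; apply: cvg_near_cst; exists 2%N => // -[//|[//|N]] _ /=.
rewrite 2!big_ord_recl big1 /= ?addr0 ?expr0 ?expr1; first by ring.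
by move=> i _; rewrite mul0r.
Qed.

(** The slope phi(t)/t takes two values on some segment of I close to 0 and avoiding 0,
    for otherwise phi would be linear on an open set, hence on I. By the intermediate value
    theorem it takes all the values in between. *)
Lemma nonlinear_interval (R : realType) (I : set R) (phi : R -> R) (rho : R) :
  is_interval I -> (exists a b, [/\ I a, I b & a < b]) -> I 0 ->
  analytic_on_itv I phi -> ~ (exists c, forall t, I t -> phi t = c * t) ->
  0 < rho ->
  exists al be, al < be /\ forall v, al <= v <= be ->
    exists t, [/\ I t, 0 < `|t|, `|t| < rho & phi t = t * v].
Proof.
move=> itvI ndI I0 an nl rho0.
have [b [Ib]] := exists_near_in_itv itvI ndI I0 rho0; rewrite subr0 => b0 brho.
have bn0 : b != 0 by rewrite -normr_gt0.
have Il l : 0 <= l <= 1 -> I (l * b).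
  move=> /andP[l0 l1]; have [bp|bn] := ltP 0 b.
    by apply: (itvI 0 b) => //; apply/andP; split; nra.
  by apply: (itvI b 0) => //; apply/andP; split; nra.
pose f l := phi (l * b) / (l * b).
have [l0 [/andP[l0h l01] fl0]] : exists l0, 1 / 2 <= l0 <= 1 /\ f l0 <> f 1.
  apply: contrapT => nex; apply: nl; exists (f 1) => t It.
  apply/eqP; rewrite -subr_eq0; apply/eqP.
  (* The midpoint of [1/2, 1], on which the slope would be constant. *)
  have h34 : I (3 / 4 * b) by apply: Il; apply/andP; split; lra.
  apply: (analytic_eq0 itvI (analytic_sub_linear (f 1) an) h34) It.
  exists (`|b| / 4); first by rewrite divr_gt0.
  move=> x Ix xb; pose l := x / b.
  have xl : x = l * b by rewrite /l divfK.
  have lb : `|l - 3 / 4| < 1 / 4.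
    have : `|l - 3 / 4| * `|b| < 1 / 4 * `|b|.
      by rewrite -normrM mulrBl -xl; lra.
    by rewrite ltr_pM2r.
  move: lb; rewrite ltr_norml => /andP[lb1 lb2].
  have -> : f 1 = f l.
    apply: contrapT => h; apply: nex; exists l; split; first by apply/andP; split; lra.
    by apply/nesym.
  have ln0 : l != 0 by rewrite gt_eqF//; lra.
  by rewrite /f -xl divfK ?subrr// xl mulf_neq0.
have l0p : 0 < l0 by lra.
have cf : {within `[l0, 1], continuous f}.
  apply/subspace_continuousP => x; rewrite /= in_itv /= => /andP[x0 x1].
  have xp : 0 < x by lra.
  have x01 : 0 <= x <= 1 by apply/andP; split; lra.
  have [chi [r [D [r0 chiD hphi]]]] := local_factor itvI ndI an (Il x x01).
  have D0 := abs_bound_ge0 chiD.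
  apply: cvgM; last first.
    apply: cvgV; first by rewrite mulf_neq0// gt_eqF.
    apply: cvgM; last exact: cvg_cst.
    by apply: cvg_within_filter; exact: cvg_id.
  apply/cvgrPdist_le => e e0.
  have b1 : 0 <= `|b| by [].
  have bD : 0 <= `|b| * D by rewrite mulr_ge0.
  have er : 0 < Num.min e r by rewrite lt_min e0.
  have [eta [eta0 h1 h2]] := exists_small b1 bD er.
  rewrite /prop_near1 /nbhs /= /within /=; apply/nbhs_ballP; exists eta => // y.
  rewrite /ball /= in_itv /= => xy /andP[y0 y1].
  have y01 : 0 <= y <= 1 by apply/andP; split; lra.
  have e1 : `|y * b - x * b| = `|x - y| * `|b| by rewrite -mulrBl normrM distrC.
  have hyr : `|y * b - x * b| <= r.
    rewrite e1; apply: le_trans (_ : `|b| * eta <= r).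
      by rewrite mulrC ler_wpM2l// ltW.
    by apply: le_trans h1 _; rewrite ge_min lexx orbT.
  have [z hz ->] := hphi _ (Il y y01) hyr.
  rewrite opprD addrA subrr sub0r normrN normrM e1.
  have zD := psum_to_le hyr chiD hz.
  apply: (@le_trans _ _ (eta * (`|b| * D))).
    by rewrite -mulrA ler_pM ?mulr_ge0// ?(ltW xy)// ler_wpM2l.
  by apply: le_trans h2 _; rewrite ge_min lexx.
have key v : Num.min (f l0) (f 1) <= v <= Num.max (f l0) (f 1) ->
    exists t, [/\ I t, 0 < `|t|, `|t| < rho & phi t = t * v].
  move=> /(IVT l01 cf)[l]; rewrite in_itv /= => /andP[ll1 ll2] flv.
  have lp : 0 < l by lra.
  have lb0 : l * b != 0 by rewrite mulf_neq0// gt_eqF.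
  exists (l * b); split.
  - by apply: Il; apply/andP; split; lra.
  - by rewrite normr_gt0.
  - by rewrite normrM gtr0_norm//; nra.
  - by rewrite -flv /f [RHS]mulrC divfK.
exists (Num.min (f l0) (f 1)), (Num.max (f l0) (f 1)); split; last exact: key.
by move/eqP: fl0; rewrite neq_lt lt_max !gt_min !ltxx => /orP[] ->; rewrite ?orbT.
Qed.

(** The coefficient of s^d in P_(d+m) is that of t^m in q_d(psi(t)), so the bound on the
    coefficients of the P_n bounds q_d(psi(t)) for t of size 1 / (2 C), that is q_d on an
    interval of slopes. *)
Lemma geom_bound_of_curves (R : realType) (I E : set R) (phi : R -> R)
    (psi : nat -> R) (r D : R) (a : nat -> nat -> R) :
  is_interval I -> (exists a b, [/\ I a, I b & a < b]) -> I 0 ->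
  analytic_on_itv I phi -> ~ (exists c, forall t, I t -> phi t = c * t) ->
  closed ([set s%:C | s in E] : set (Cplx R)) ->
  (0 < cap [set s%:C | s in E])%E ->
  0 < r -> abs_bound psi r D ->
  (forall t, I t -> `|t| <= r -> exists2 y, psum_to psi t y & phi t = t * y) ->
  (forall s, E s -> exists t x, t != 0 /\ psum_to (curve_coef a s (fun n => s * psi n)) t x) ->
  exists r0 A, 0 < r0 /\ geom_bound a r0 A.
Proof.
move=> itvI ndI I0 an nl cE capE r0 psiD phiE Ea.
have sP n : (size (slice_poly a psi n) <= n.+1)%N by exact: size_poly.
have PE s : E s -> exists C, forall n, `|(slice_poly a psi n).[s]| <= C ^+ n.+1.
  move=> /Ea[t [x [t0 ax]]]; have [C HC] := psum_coef_exp t0 ax.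
  by exists C => n; rewrite horner_slice_poly.
have [C C1 HC] := pos_cap_coef_bound cE capE sP PE.
move: capE => _.
have C0 : 0 < C by exact: lt_le_trans C1.
have rowle d m : `|curve_row a 1 psi d m| <= C ^+ (d + m).+1.
  have := HC (d + m)%N d; rewrite coef_poly ltnS leq_addr.
  by have -> : (d + m - d = m)%N by lia.
have rowb d : abs_bound (curve_row a 1 psi d) (C^-1 / 2) (C ^+ d.+1 * 2).
  apply: abs_bound_of_terms => [|m]; first by rewrite invr_ge0 ltW.
  rewrite exprVn ler_pdivrMr ?exprn_gt0// -exprD addSn.
  exact: rowle.
have rho0 : 0 < Num.min r (C^-1 / 2) by rewrite lt_min r0 divr_gt0// invr_gt0.
have [al [be [albe HI]]] := nonlinear_interval itvI ndI I0 an nl rho0.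
have [C2 C21 HC2] := interval_coef_bound albe.
have C20 : 0 < C2 by exact: lt_le_trans C21.
have CC0 : 0 < C * C2 by rewrite mulr_gt0.
exists (C * C2)^-1, (2 * (C * C2)); split; first by rewrite invr_gt0.
move=> i j; rewrite -mulrA -exprD exprVn ler_pdivrMr ?exprn_gt0//.
have sq : (size (homog_poly a (i + j)) <= (i + j).+1)%N by exact: size_poly.
have qb v : al <= v <= be -> `|(homog_poly a (i + j)).[v]| <= C ^+ (i + j).+1 * 2.
  move=> /HI[t [It t0 trho phitv]].
  have tr : `|t| <= r by apply/ltW/(lt_le_trans trho); rewrite ge_min lexx.
  have tC : `|t| <= C^-1 / 2.
    by apply/ltW/(lt_le_trans trho); rewrite ge_min lexx orbT.
  have [y psiy phity] := phiE t It tr.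
  have vy : v = y.
    by apply: (mulfI (_ : t != 0)); [rewrite -normr_gt0|rewrite -phitv].
  rewrite vy; apply: psum_to_le tC (rowb _) _.
  exact: psum_curve_row tr psiD psiy.
have := HC2 _ _ _ sq qb j.
rewrite coef_poly ltnS leq_addl addnK => h; apply: le_trans h _.
rewrite le_eqVlt; apply/orP; left; apply/eqP.
by rewrite exprMn !exprS; ring.
Qed.

Lemma real_closed_away0 (R : realType) (E : set R) :
  closed ([set s%:C | s in E] : set (Cplx R)) -> ~ E 0 ->
  exists2 del : R, 0 < del & forall s, E s -> del <= `|s|.
Proof.
move=> cE E0.
have := closed_openC cE; rewrite openE => /(_ (0 : R[i])) /=.
move=> /(_ _)/nbhs_ballP[|e /= e0 he].
  by move=> [s Es /(congr1 (@complex.Re R)) /= s0]; apply: E0; rewrite -s0.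
move: e0; rewrite ltcE /= => /andP[/eqP eIm eRe].
exists (complex.Re e) => // s Es; rewrite leNgt; apply/negP => se.
apply: (he s%:C); last by exists s.
rewrite /ball /= sub0r normrN normc_normr normc_real ltcE /=.
by rewrite eIm eqxx.
Qed.

(** The radius rho is uniform in s because |s| is bounded below on E and |phi(t)| is at
    most D |t|: along each curve the parameters with |s t| < rho form an interval that is
    mapped into the square where the Taylor series converges, which is what the identity
    theorem requires. *)
Lemma real_valued_extension (R : realType) (Om : set (R * R)) (u : R * R -> R)
    (I E : set R) (phi : R -> R) :
  open Om -> Om (0, 0) -> (forall k, Ck k Om u) ->
  is_interval I -> (exists a b, [/\ I a, I b & a < b]) -> I 0 ->
  analytic_on_itv I phi -> phi 0 = 0 ->
  ~ (exists c, forall t, I t -> phi t = c * t) ->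
  ~ E 0 -> closed ([set s%:C | s in E] : set (Cplx R)) ->
  (0 < cap [set s%:C | s in E])%E ->
  (forall s, E s -> exists G : R * R -> R, forall p,
     (dilated_curve I phi s `&` Om) p -> analytic_at G p /\ u p = G p) ->
  exists rho F, [/\ 0 < rho,
    forall p : R * R, `|p.1| < rho -> `|p.2| < rho -> Om p /\ analytic_at F p &
    forall s t, E s -> I t -> `|s * t| < rho ->
      F (s * t, s * phi t) = u (s * t, s * phi t)].
Proof.
move=> Oop O0 smooth itvI ndI I0 an phi0 nl E0 cE capE curves.
have [d0 d00 box] : exists2 d0, 0 < d0 & forall x y, `|x| <= d0 -> `|y| <= d0 -> Om (x, y).
  move: Oop; rewrite openE => /(_ _ O0)/nbhs_ballP[e /= e0 he].
  exists (e / 2); first by rewrite divr_gt0.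
  by move=> x y xe ye; apply: he; split; rewrite /ball /= sub0r normrN; lra.
have [psi [r [D [r0 psiD hphi]]]] := local_factor itvI ndI an I0.
have D0 := abs_bound_ge0 psiD.
have phiE t : I t -> `|t| <= r -> exists2 y, psum_to psi t y & phi t = t * y.
  move=> It tr; have := hphi t It; rewrite subr0 => /(_ tr)[y hy ->].
  by exists y; rewrite ?phi0 ?add0r.
have [del del0 Edel] := real_closed_away0 cE E0.
pose a := taylor_coef u.
have ucurve s : E s -> exists2 rho, 0 < rho & forall t, I t -> `|t| <= rho ->
    psum_to (curve_coef a s (fun n => s * psi n)) t (u (s * t, s * phi t)).
  move=> Es; have [G HG] := curves s Es.
  have sD0 : 0 <= `|s| * D by rewrite mulr_ge0.
  have [e [e0 h1 h2]] := exists_small (normr_ge0 s) sD0 d00.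
  apply: (taylor_along_curve (G := G) d00 box smooth itvI ndI I0 r0 psiD phiE).
    apply: (HG (0, 0) _).1; split => //; exists 0 => //.
    by rewrite phi0 !mulr0.
  exists (Num.min e r); first by rewrite lt_min e0.
  move=> t It; rewrite lt_min => /andP[te tr].
  apply: (HG _ _).2; split; first by exists t.
  have [y psiy ->] := phiE t It (ltW tr).
  have yD := psum_to_le (ltW tr) psiD psiy.
  apply: box; first by rewrite normrM; apply: le_trans h1; rewrite ler_wpM2l// ltW.
  apply: le_trans h2; rewrite mulrCA !normrM.
  by apply: ler_pM => //; [exact: ltW|rewrite ler_wpM2l].
have [r1 [A [r10 aA]]] : exists r1 A, 0 < r1 /\ geom_bound a r1 A.
  apply: (geom_bound_of_curves itvI ndI I0 an nl cE capE r0 psiD phiE).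
  move=> s /ucurve[rho rho0 h].
  have [t [It]] := exists_near_in_itv itvI ndI I0 rho0; rewrite subr0 => t0 trho.
  exists t, (u (s * t, s * phi t)); split; first by rewrite -normr_gt0.
  exact: h It (ltW trho).
move: capE => _.
pose rho0 := Num.min d0 (r1 / 8).
have rho00 : 0 < rho0 by rewrite lt_min d00 divr_gt0.
have rhod : rho0 <= d0 by rewrite ge_min lexx.
have rhor1 : rho0 <= r1 / 8 by rewrite ge_min lexx orbT.
(* The first bound keeps s phi(t) within rho0, the second one keeps t within r. *)
pose rho := Num.min (rho0 / (D + 1)) (del * r).
have D1 : 0 < D + 1 by lra.
have rhoD : rho <= rho0 / (D + 1) by rewrite ge_min lexx.
have rhodel : rho <= del * r by rewrite ge_min lexx orbT.
have rho_gt0 : 0 < rho by rewrite lt_min divr_gt0// mulr_gt0.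
have rhoD' : rho * D + rho <= rho0.
  by move: rhoD; rewrite ler_pdivlMr// mulrDr mulr1.
have rhoDpos : 0 <= rho * D by rewrite mulr_ge0// ltW.
have rhorho0 : rho <= rho0 by lra.
have inbox p : `|p.1| < rho0 -> `|p.2| < rho0 -> Om p /\ analytic_at (dsum a) p.
  move=> p1 p2; split.
    by case: p p1 p2 => x y /= x1 y1; apply: box; lra.
  by apply: dsum_analytic aA _ _ => //; lra.
exists rho, (dsum a); split => //.
  by move=> p p1 p2; apply: inbox; exact: lt_le_trans rhorho0.
move=> s t Es It strho.
have s0 : 0 < `|s| by exact: lt_le_trans (Edel s Es).
pose J : set R := [set x | I x /\ `|s * x| < rho].
have Jphi x : J x -> `|s * x| < rho0 /\ `|s * phi x| < rho0.
  move=> [Ix sx]; split; first exact: lt_le_trans rhorho0.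
  have xr : `|x| <= r.
    have h : del * `|x| <= `|s| * `|x| by rewrite ler_wpM2r// Edel.
    have : del * `|x| <= del * r by move: sx; rewrite normrM; lra.
    by rewrite ler_pM2l.
  have [y psiy ->] := phiE x Ix xr.
  have yD := psum_to_le xr psiD psiy.
  rewrite mulrA normrM; have : `|s * x| * `|y| <= rho * D by rewrite ler_pM// ltW.
  lra.
have JOm x : J x -> (dilated_curve I phi s `&` Om) (s * x, s * phi x).
  move=> Jx; have [h1 h2] := Jphi x Jx; split; last by have [] := inbox (_, _) h1 h2.
  by exists x => //; case: Jx.
have J0 : J 0 by split => //; rewrite mulr0 normr0.
have itvJ : is_interval J.
  move=> x y [Ix sx] [Iy sy] z xzy; split; first exact: itvI xzy.
  move: sx sy; rewrite !normrM -!ltr_pdivlMl// !ltr_norml => /andP[x1 x2] /andP[y1 y2].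
  by move: xzy => /andP[? ?]; apply/andP; split; lra.
have [G HG] := curves s Es.
pose g x := u (s * x, s * phi x) - dsum a (s * x, s * phi x).
have ang : analytic_on_itv J g.
  move=> x Jx; have [Ix _] := Jx.
  have [chi [r2 [D2 [r20 chiD hchi]]]] := local_factor itvI ndI an Ix.
  have [aG _] := HG _ (JOm x Jx).
  have [h1 h2] := Jphi x Jx.
  have [_ aF] := inbox (s * x, s * phi x) h1 h2.
  have schiD := abs_boundZ s chiD.
  have [c1 [e1 [e10 hc1]]] := analytic_along_curve s aG r20 schiD.
  have [c2 [e2 [e20 hc2]]] := analytic_along_curve s aF r20 schiD.
  exists (fun n => c1 n - c2 n), (Num.min r2 (Num.min e1 e2)).
  split; first by rewrite !lt_min r20 e10.
  move=> y Jy; have [Iy _] := Jy; rewrite !lt_min => /and3P[yr2 ye1 ye2].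
  have [z hz phiy] := hchi y Iy (ltW yr2).
  have hz' := psum_toZ (s := s) hz.
  have e1' : s * x + s * (y - x) = s * y by ring.
  have e2' : s * phi x + (y - x) * (s * z) = s * phi y by rewrite phiy; ring.
  apply/psum_to_pseries; rewrite /g (HG _ (JOm y Jy)).2.
  have q1 := hc1 _ _ (ltW ye1) hz'; have q2 := hc2 _ _ (ltW ye2) hz'.
  rewrite /= e1' e2' in q1 q2.
  exact: psum_toB q1 q2.
have [rho1 rho10 hu] := ucurve s Es.
have [rho2 [rho20 rho2r hF]] := dsum_along_curve s r10 aA r0 (abs_boundZ s psiD).
suff g0 : g t = 0 by apply/esym/eqP; rewrite -subr_eq0; apply/eqP.
apply: (analytic_eq0 itvJ ang J0) => //.
exists (Num.min rho1 rho2); first by rewrite lt_min rho10.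
move=> x [Ix sx]; rewrite subr0 lt_min => /andP[x1 x2].
have xr : `|x| <= r by exact: le_trans (ltW x2) rho2r.
have [y psiy phix] := phiE x Ix xr.
have [_ _ q] := hF x (s * y) (ltW x2) (psum_toZ (s := s) psiy).
have e : x * (s * y) = s * phi x by rewrite phix; ring.
rewrite e in q; rewrite /g (psum_to_unique (hu x Ix (ltW x1)) q).
exact: subrr.
Qed.

Lemma open_square (R : realType) (rho : R) :
  open [set p : R * R | `|p.1| < rho /\ `|p.2| < rho].
Proof.
rewrite openE => -[x y] /= [p1 p2]; apply/nbhs_ballP.
exists (Num.min (rho - `|x|) (rho - `|y|)).
  by rewrite /= lt_min !subr_gt0 p1.
move=> [x' y'] []; rewrite /ball /= !lt_min => /andP[q1 _] /andP[_ q2].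
have h1 := ler_normB x (x - x'); have h2 := ler_normB y (y - y').
by rewrite !subKr in h1 h2; split; lra.
Qed.

Theorem theorem2p1 (R : realType)
  (Om : set (R * R)) (f : R * R -> R[i])
  (I : set R) (phi : R -> R) (E : set R)
  (Om_open : open Om) (Om0 : Om (0, 0)) (f_smooth : smooth_on Om f)
  (I_itv : is_interval I) (I_nondeg : exists a b, [/\ I a, I b & a < b])
  (I0 : I 0)
  (phi_analytic : analytic_on_itv I phi) (phi0 : phi 0 = 0)
  (phi_nonlinear : ~ exists c : R, forall t, I t -> phi t = c * t)
  (E0 : ~ E 0)
  (E_closed : closed ([set s%:C | s in E] : set (Cplx R)))
  (E_cap : (0 < cap [set s%:C | s in E])%E)
  (f_analytic_along : forall s, E s ->
     exists (Q : set (R * R)) (Fs : R * R -> R[i]),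
       [/\ open Q,
           dilated_curve I phi s `&` Om `<=` Q,
           analytic_on Q Fs &
           forall p, (dilated_curve I phi s `&` Om) p -> f p = Fs p]) :
  exists (U : set (R * R)) (F : R * R -> R[i]),
    [/\ open U, U (0, 0), U `<=` Om,
        analytic_on U F &
        forall p, (U `&` \bigcup_(s in E) dilated_curve I phi s) p ->
          F p = f p].
Proof.
have curvesRe s : E s -> exists G : R * R -> R, forall p,
    (dilated_curve I phi s `&` Om) p ->
    analytic_at G p /\ complex.Re (f p) = G p.
  move=> /f_analytic_along[Q [Fs [_ sub anF fF]]].
  exists (fun q => complex.Re (Fs q)) => p Hp.
  by split; [exact: (anF p (sub p Hp)).1|rewrite fF].
have curvesIm s : E s -> exists G : R * R -> R, forall p,
    (dilated_curve I phi s `&` Om) p ->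
    analytic_at G p /\ complex.Im (f p) = G p.
  move=> /f_analytic_along[Q [Fs [_ sub anF fF]]].
  exists (fun q => complex.Im (Fs q)) => p Hp.
  by split; [exact: (anF p (sub p Hp)).2|rewrite fF].
have [r1 [F1 [r10 an1 ag1]]] := real_valued_extension Om_open Om0
  (fun k => (f_smooth k).1) I_itv I_nondeg I0 phi_analytic phi0 phi_nonlinear
  E0 E_closed E_cap curvesRe.
have [r2 [F2 [r20 an2 ag2]]] := real_valued_extension Om_open Om0
  (fun k => (f_smooth k).2) I_itv I_nondeg I0 phi_analytic phi0 phi_nonlinear
  E0 E_closed E_cap curvesIm.
move: E_cap => _.
pose rho := Num.min r1 r2.
have rho0 : 0 < rho by rewrite lt_min r10.
exists [set p : R * R | `|p.1| < rho /\ `|p.2| < rho], (fun q => F1 q +i* F2 q).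
split.
- exact: open_square.
- by rewrite /= normr0.
- by move=> p /= [p1 p2]; apply: (an1 p _ _).1; rewrite (lt_le_trans p1, lt_le_trans p2)// ge_min lexx.
- move=> p /= [p1 p2]; move: p1 p2; rewrite !lt_min => /andP[p11 p12] /andP[p21 p22].
  by split; [exact: (an1 p p11 p21).2|exact: (an2 p p12 p22).2].
move=> p [/= [p1 p2] [s Es [t It pE]]]; move: p1 p2.
rewrite -pE /= !lt_min => /andP[s1 s2] _.
by rewrite ag1// ag2//; case: (f _).
Qed.
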